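(* Let $\Lambda$ be a finitely aligned $k$-graph such that $C^*(\Lambda)$ is AF. Then for every saturated hereditary subset $H$ of $\Lambda^0$, and every pair $\eta,\zeta$ of distinct paths in $\Lambda\setminus\Lambda H$ with $s(\eta)=s(\zeta)$, there exists $\tau\in s(\eta)\Lambda\setminus\Lambda H$ such that $\mathrm{MCE}(\eta\tau,\zeta\tau)\subseteq\Lambda H$. Moreover every (closed two-sided) ideal of $C^*(\Lambda)$ is gauge-invariant.
   Context: Let $\mathbb N=\{0,1,2,\dots\}$ and $k\ge 1$; order $\mathbb N^k$ coordinatewise, with $m\vee n$ the coordinatewise maximum. A $k$-graph is a countable small category $\Lambda$ with a functor $d:\Lambda\to\mathbb N^k$ (the degree) satisfying the factorisation property: if $d(\lambda)=m+n$ then there are unique $\mu,\nu\in\Lambda$ with $d(\mu)=m$, $d(\nu)=n$, $\lambda=\mu\nu$. Put $\Lambda^n=d^{-1}(n)$. Elements of $\Lambda^0$ are the identity morphisms, identified with the objects and called vertices; elements of $\Lambda$ are called paths; $r,s:\Lambda\to\Lambda^0$ are the codomain and domain maps, so $\mu\nu$ is defined when $s(\mu)=r(\nu)$. For $v\in\Lambda^0$ and $E\subseteq\Lambda$, $vE=\{\lambda\in E: r(\lambda)=v\}$. For $H\subseteq\Lambda^0$, $\Lambda H=\{\lambda\in\Lambda: s(\lambda)\in H\}$. For $\mu,\nu\in\Lambda$, $\mathrm{MCE}(\mu,\nu)$ is the set of $\lambda\in\Lambda$ with $d(\lambda)=d(\mu)\vee d(\nu)$ and $\lambda=\mu\mu'=\nu\nu'$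 for some $\mu',\nu'\in\Lambda$. $\Lambda$ is finitely aligned if $\mathrm{MCE}(\mu,\nu)$ is finite (possibly empty) for all $\mu,\nu$. A set $F\subseteq v\Lambda$ is exhaustive if for every $\lambda\in v\Lambda$ there is $\mu\in F$ with $\mathrm{MCE}(\lambda,\mu)\ne\emptyset$. A set $H\subseteq\Lambda^0$ is hereditary if $r(\lambda)\in H$ implies $s(\lambda)\in H$ for all $\lambda\in\Lambda$; it is saturated if whenever $v\in\Lambda^0$ and there is a finite exhaustive set $F\subseteq v\Lambda$ with $s(F)\subseteq H$, we have $v\in H$. For finitely aligned $\Lambda$, $C^*(\Lambda)$ is the universal $C^*$-algebra generated by a Cuntz–Krieger $\Lambda$-family $\{s_\lambda:\lambda\in\Lambda\}$, i.e. elements such that (CK1) the $s_v$, $v\in\Lambda^0$, are mutually orthogonal projections; (CK2) $s_\mu s_\nu=s_{\mu\nu}$ when $s(\mu)=r(\nu)$; (CK3) $s_\mu^*s_\nu=\sum_{\mu\alpha=\nu\beta\in\mathrm{MCE}(\mu,\nu)}s_\alpha s_\beta^*$ for all $\mu,\nu$; (CK4) $\prod_{\lambda\in E}(s_v-s_\lambda s_\lambda^* )=0$ for all $v\in\Lambda^0$ and finite exhaustive $E\subseteq v\Lambda$. The gauge action is the strongly continuous action $\gamma$ of $\mathbb T^k$ on $C^*(\Lambda)$ with $\gamma_z(s_\lambda)=z^{d(\lambda)}s_\lambda$, where $z^{n}=z_1^{n_1}\cdots z_k^{n_k}$. An ideal $I$ is gauge-invariant if $\gamma_z(I)\subseteq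 I$ for all $z\in\mathbb T^k$. *)

(* Defs.v *)
From HB Require Import structures.
From mathcomp Require Import all_boot all_order all_algebra.
From mathcomp Require Import all_classical all_reals all_analysis.
From mathcomp Require Import finmap complex.

Set Implicit Arguments.
Unset Strict Implicit.
Unset Printing Implicit Defensive.

Import Order.TTheory GRing.Theory Num.Theory.
Import numFieldNormedType.Exports.

Local Open Scope classical_set_scope.
Local Open Scope ring_scope.
Local Open Scope complex_scope.

(* Arrows are the elements of the category; [idp v] is the identity morphism
   at the object [v].  Composition is total as a function, but it is only
   constrained, and only ever used, on pairs with [src mu = rng nu]. *)
Record kgraph (k : nat) := KGraph {
  vertex : countType;
  kpath : countType;
  rng : kpath -> vertex;
  src : kpath -> vertex;
  idp : vertex -> kpath;
  kgcomp : kpath -> kpath -> kpath;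
  deg : kpath -> {ffun 'I_k -> nat};
  rng_idp : forall v, rng (idp v) = v;
  src_idp : forall v, src (idp v) = v;
  rng_comp : forall mu nu, src mu = rng nu -> rng (kgcomp mu nu) = rng mu;
  src_comp : forall mu nu, src mu = rng nu -> src (kgcomp mu nu) = src nu;
  comp_idl : forall mu, kgcomp (idp (rng mu)) mu = mu;
  comp_idr : forall mu, kgcomp mu (idp (src mu)) = mu;
  compA : forall la mu nu, src la = rng mu -> src mu = rng nu ->
    kgcomp la (kgcomp mu nu) = kgcomp (kgcomp la mu) nu;
  deg_idp : forall v, deg (idp v) = 0;
  deg_comp : forall mu nu, src mu = rng nu -> deg (kgcomp mu nu) = deg mu + deg nu;
  factorisation : forall la m n, deg la = m + n ->
    exists! p : kpath * kpath,
      [/\ deg p.1 = m, deg p.2 = n, src p.1 = rng p.2 & la = kgcomp p.1 p.2]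
}.

Section KGraph.
Variables (k : nat) (L : kgraph k).
Implicit Types (mu nu la : kpath L) (v : vertex L) (H : set (vertex L)).

Definition deg_join (m n : {ffun 'I_k -> nat}) : {ffun 'I_k -> nat} :=
  [ffun i => maxn (m i) (n i)].

Definition extends la mu : Prop :=
  exists mu', src mu = rng mu' /\ la = kgcomp mu mu'.

Definition MCE mu nu : set (kpath L) :=
  [set la | [/\ deg la = deg_join (deg mu) (deg nu), extends la mu & extends la nu]].

Definition finitely_aligned : Prop := forall mu nu, finite_set (MCE mu nu).

Definition exhaustive v (F : set (kpath L)) : Prop :=
  F `<=` [set la | rng la = v] /\
  forall la, rng la = v -> exists2 mu, F mu & MCE la mu !=set0.

Definition hereditary H : Prop := forall la, H (rng la) -> H (src la).

Definition saturated H : Prop :=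
  forall v (F : set (kpath L)),
    finite_set F -> exhaustive v F -> (@src k L) @` F `<=` H -> H v.

Definition paths_into H : set (kpath L) := [set la | H (src la)].

End KGraph.

(* MathComp rings are unital, whereas C*-algebras need not be: the product is
   added to a complex Banach space. *)
HB.mixin Record isCstarAlgebra (R : realType) A
    of CompleteNormedModule R[i] A := {
  cmul : A -> A -> A;
  cstar : A -> A;
  cmulA : forall x y z, cmul x (cmul y z) = cmul (cmul x y) z;
  cmulDl : forall x y z, cmul (x + y) z = cmul x z + cmul y z;
  cmulDr : forall x y z, cmul x (y + z) = cmul x y + cmul x z;
  cmulZl : forall (a : R[i]) x y, cmul (a *: x) y = a *: cmul x y;
  cmulZr : forall (a : R[i]) x y, cmul x (a *: y) = a *: cmul x y;
  cstarK : forall x, cstar (cstar x) = x;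
  cstarD : forall x y, cstar (x + y) = cstar x + cstar y;
  cstarZ : forall (a : R[i]) x, cstar (a *: x) = a^* *: cstar x;
  cstarM : forall x y, cstar (cmul x y) = cmul (cstar y) (cstar x);
  cnorm_mul : forall x y, `|cmul x y| <= `|x| * `|y|;
  cnorm_star : forall x, `|cmul (cstar x) x| = `|x| ^+ 2
}.

#[short(type="cstarAlgType")]
HB.structure Definition CstarAlgebra (R : realType) :=
  { A of CompleteNormedModule R[i] A & isCstarAlgebra R A }.

Section Cstar.
Variable R : realType.
Implicit Types A B : cstarAlgType R.

Record star_hom A B (f : A -> B) : Prop := StarHom {
  star_homD : forall x y, f (x + y) = f x + f y;
  star_homZ : forall (a : R[i]) x, f (a *: x) = a *: f x;
  star_homM : forall x y, f (cmul x y) = cmul (f x) (f y);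
  star_homS : forall x, f (cstar x) = cstar (f x)
}.

Record star_subalgebra A (B : set A) : Prop := StarSubalgebra {
  subalg0 : B 0;
  subalgD : forall x y, B x -> B y -> B (x + y);
  subalgZ : forall (a : R[i]) x, B x -> B (a *: x);
  subalgM : forall x y, B x -> B y -> B (cmul x y);
  subalgS : forall x, B x -> B (cstar x)
}.

Record closed_ideal A (I : set A) : Prop := ClosedIdeal {
  ideal0 : I 0;
  idealD : forall x y, I x -> I y -> I (x + y);
  idealZ : forall (a : R[i]) x, I x -> I (a *: x);
  idealMl : forall x y, I y -> I (cmul x y);
  idealMr : forall x y, I x -> I (cmul x y);
  ideal_closed : closed I
}.

Definition finite_dimensional A (B : set A) : Prop :=
  exists (n : nat) (b : 'I_n -> A),
    forall x, B x -> exists c : 'I_n -> R[i], x = \sum_(i < n) c i *: b i.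

Definition is_AF A : Prop :=
  exists F : nat -> set A,
    [/\ forall n, star_subalgebra (F n),
        forall n, finite_dimensional (F n),
        forall n, F n `<=` F n.+1 &
        closure (\bigcup_n F n) = setT].

Definition projection A (p : A) : Prop := cmul p p = p /\ cstar p = p.

(* There is no unit to serve as the empty product; exhaustive sets are
   nonempty, so the value on [::] is never used. *)
Definition cprod A (s : seq A) : A :=
  if s is x :: s' then foldl cmul x s' else 0.

End Cstar.

(* The ascription selects the normed-field topology on R[i], from which the
   matrix type gets the product topology. *)
Notation cvec R k := 'rV[complex R : numFieldType]_k.

Section CuntzKrieger.
Variables (R : realType) (k : nat) (L : kgraph k).

Record CK_family (A : cstarAlgType R) (S : kpath L -> A) : Prop := CKFamily {
  CK1_proj : forall v, projection (S (idp v));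
  CK1_orth : forall v w, v <> w -> cmul (S (idp v)) (S (idp w)) = 0;
  CK2 : forall mu nu, src mu = rng nu -> cmul (S mu) (S nu) = S (kgcomp mu nu);
  CK3 : forall mu nu,
    cmul (cstar (S mu)) (S nu) =
    \sum_(p \in [set p : kpath L * kpath L |
        [/\ src mu = rng p.1, src nu = rng p.2,
            kgcomp mu p.1 = kgcomp nu p.2 & MCE mu nu (kgcomp mu p.1)]])
      cmul (S p.1) (cstar (S p.2));
  CK4 : forall v (E : {fset kpath L}), exhaustive v [set` E] ->
    cprod [seq S (idp v) - cmul (S la) (cstar (S la)) | la <- enum_fset E] = 0
}.

(* [A], with the family [S], is the universal C*-algebra generated by a
   Cuntz-Krieger family; this determines (A, S) up to isomorphism. *)
Record is_graph_algebra (A : cstarAlgType R) (S : kpath L -> A) : Prop :=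
  IsGraphAlgebra {
  graph_algebra_CK : CK_family S;
  graph_algebra_generated : forall B : set A,
    star_subalgebra B -> closed B -> (forall la, B (S la)) -> B = setT;
  graph_algebra_universal : forall (B : cstarAlgType R) (T : kpath L -> B),
    CK_family T -> exists2 f : A -> B, star_hom f & forall la, f (S la) = T la
}.

Definition torus : set (cvec R k) :=
  [set z | forall i, `|z 0 i| = 1].

Definition torus_mul (z w : cvec R k) :=
  \row_i (z 0 i * w 0 i).

Definition torus_exp (z : cvec R k)
    (n : {ffun 'I_k -> nat}) : R[i] :=
  \prod_i z 0 i ^+ n i.

(* [gam] is a family of maps indexed by all of C^k; only its values on the
   torus are constrained, and only those are used. *)
Record gauge_action (A : cstarAlgType R) (S : kpath L -> A)
    (gam : cvec R k -> A -> A) : Prop := GaugeAction {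
  gauge_hom : forall z, torus z -> star_hom (gam z);
  gauge1 : forall x, gam (const_mx 1) x = x;
  gaugeM : forall z w x, torus z -> torus w ->
    gam (torus_mul z w) x = gam z (gam w x);
  gauge_continuous : forall x, {within torus, continuous (fun z => gam z x)};
  gauge_generator : forall z la, torus z ->
    gam z (S la) = torus_exp z (deg la) *: S la
}.

Definition gauge_invariant (A : cstarAlgType R)
    (gam : cvec R k -> A -> A) (I : set A) : Prop :=
  forall z, torus z -> gam z @` I `<=` I.

End CuntzKrieger.

(* Main.v *)
Require Import Defs.
From HB Require Import structures.
From mathcomp Require Import all_boot all_order all_algebra.
From mathcomp Require Import all_classical all_reals all_analysis.
From mathcomp Require Import finmap complex.
From mathcomp Require Import ring lra.

Set Implicit Arguments.
Unset Strict Implicit.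
Unset Printing Implicit Defensive.
Import Order.TTheory GRing.Theory Num.Theory.
Import numFieldNormedType.Exports.

Local Open Scope classical_set_scope.
Local Open Scope ring_scope.

(* Let A be AF, I a closed ideal and x in I.  Approximate x^* x by a self-adjoint
   element of a finite-dimensional subalgebra and take its spectral projections:
   those with eigenvalue away from 0 lie at distance < 1 from I, hence in I, and
   their sum p satisfies x = x p up to a small error.  A projection of I is moved by
   the strongly continuous action of the connected group T^k through projections
   at distance < 1 from one another, so it stays in I.  As star-homomorphisms are
   contractive, I is gauge-invariant.

   Suppose aperiodicity fails for H, eta and zeta.  Paths of Lambda \ Lambda H act
   by partial isometries on l^2 of the maximal filters x of paths avoiding H, and
   this is a Cuntz-Krieger family T.  Failure means that eta x = zeta x for every x,
   so T_eta T_zeta^* = T_eta T_eta^*; by gauge invariance of the kernel of the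
   induced homomorphism, and since d(eta) <> d(zeta), T_eta T_eta^* = 0, which is
   absurd as s(eta) is not in H. *)

(** * C*-algebras and their star-homomorphisms *)

Section RealNorm.
Local Open Scope complex_scope.
Variables (R : realType) (V : normedModType R[i]).
Implicit Types x y : V.

(** Everything analytic is drawn from the C*-identity in algebras without unit, so [1 - p] or
    [a - z] occur only as operators acting on elements. Projections are chosen because for them
    membership in a closed ideal is an open condition: distance less than 1 from the ideal already
    forces it. Connectedness of the torus enters as the fact that every [z] is a power of some [w]
    as close to 1 as desired.

    Instead of dividing by the ideal generated by the [s_v] with [v] in [H], the aperiodicity
    argument uses a representation in which these vanish. The filters must be maximal for two
    reasons: a maximal filter meets every finite exhaustive set at its range, which is (CK4) and the
    place where saturation acts; and compatible maximal filters coincide, which turns common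
    extensions outside [Lambda H] into the equality of [eta x] and [zeta x]. The degrees of [eta]
    and [zeta] differ because distinct paths of equal degree have no common extension, whereas
    failure of aperiodicity at the trivial [tau] provides one. *)

Definition rnorm x : R := complex.Re `|x|.

Lemma rnormE x : `|x| = (rnorm x)%:C.
Proof. by rewrite /rnorm RRe_real. Qed.

Lemma rnorm_ge0 x : 0 <= rnorm x.
Proof. by rewrite -ler0c -rnormE. Qed.

Lemma rnorm0 : rnorm (0 : V) = 0.
Proof. by rewrite /rnorm normr0. Qed.

Lemma rnorm_eq0 x : rnorm x = 0 -> x = 0.
Proof. by move=> h; apply/normr0_eq0; rewrite rnormE h. Qed.

Lemma rnormD x y : rnorm (x + y) <= rnorm x + rnorm y.
Proof. by rewrite -lecR rmorphD /= -!rnormE ler_normD. Qed.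

Lemma rnormN x : rnorm (- x) = rnorm x.
Proof. by rewrite /rnorm normrN. Qed.

Lemma rnormB x y : rnorm (x - y) <= rnorm x + rnorm y.
Proof. by rewrite -(rnormN y) rnormD. Qed.

Lemma rdistC x y : rnorm (x - y) = rnorm (y - x).
Proof. by rewrite /rnorm distrC. Qed.

Lemma rnormZ (a : R[i]) x : rnorm (a *: x) = complex.Re `|a| * rnorm x.
Proof.
apply: (@complexI R); rewrite -rnormE normrZ [RHS]rmorphM.
by congr (_ * _); rewrite [RHS]RRe_real.
Qed.

Lemma closed_rnorm (D : set V) x : closed D ->
  (forall e : R, 0 < e -> exists2 y, D y & rnorm (x - y) < e) -> D x.
Proof.
move=> cD h; apply: cD => B /nbhs_ballP[e /= e0 eB].
have e0' : 0 < complex.Re e by move: e0; rewrite ltcE /= => /andP[].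
have [y Dy xy] := h _ e0'; exists y; split => //; apply: eB.
rewrite -ball_normE /ball_ /= rnormE.
suff -> : e = (complex.Re e)%:C by rewrite ltcR.
by rewrite RRe_real// gtr0_real.
Qed.

End RealNorm.

Section Complete.
Local Open Scope complex_scope.
Variables (R : realType) (V : completeNormedModType R[i]).

Lemma rnorm_complete (u : nat -> V) :
  (forall e : R, 0 < e -> exists N, forall m n, (N <= m)%N -> (N <= n)%N ->
     rnorm (u m - u n) < e) ->
  exists l, forall e : R, 0 < e -> exists N, forall n, (N <= n)%N ->
    rnorm (u n - l) < e.
Proof.
move=> h.
have : cvgn u.
  apply/cauchy_cvgP/cauchyP => e e0.
  have e0' : 0 < complex.Re e by move: e0; rewrite ltcE /= => /andP[].
  have [N hN] := h _ e0'; exists (u N); exists N => //= n /= Nn.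
  rewrite -ball_normE /ball_ /= rnormE.
  suff -> : e = (complex.Re e)%:C by rewrite ltcR hN.
  by rewrite RRe_real// gtr0_real.
move=> /cvg_ex[l /cvgrPdist_lt ul]; exists l => e e0.
have e0' : 0 < e%:C :> R[i] by rewrite ltcR.
have [N _ hN] := ul _ e0'; exists N => n Nn.
by have := hN n Nn; rewrite rnormE ltcR rdistC.
Qed.

(** Banach's fixed point theorem on a subset [D] that contains its limit points. It produces the
    square root in [half_sqrt]. *)
Lemma rnorm_fixpoint (D : set V) (F : V -> V) (q : R) (u0 : V) :
  0 <= q < 1 ->
  (forall x, (forall e : R, 0 < e -> exists2 y, D y & rnorm (x - y) < e) -> D x) ->
  D u0 -> (forall x, D x -> D (F x)) ->
  (forall x y, D x -> D y -> rnorm (F x - F y) <= q * rnorm (x - y)) ->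
  exists2 l, D l & F l = l.
Proof.
move=> /andP[q0 q1] cD Du0 DF ctr.
pose u n := iter n F u0.
have Du n : D (u n) by elim: n => //= n; apply: DF.
pose K := rnorm (u 1%N - u 0%N) / (1 - q).
have K0 : 0 <= K by rewrite divr_ge0 ?rnorm_ge0// subr_ge0 ltW.
have step n : rnorm (u n.+1 - u n) <= q ^+ n * rnorm (u 1%N - u 0%N).
  elim: n => [|n ih]; first by rewrite expr0 mul1r.
  apply: (le_trans (ctr (u n.+1) (u n) (Du _) (Du _))).
  by rewrite exprS -mulrA ler_wpM2l.
(* The right-hand side is the exact sum of the geometric bounds in [step] from [n] to [n + m - 1],
   so the induction step closes with an identity. *)
have far n m : rnorm (u (n + m)%N - u n) <= K * (q ^+ n - q ^+ (n + m)).
  elim: m => [|m ih]; first by rewrite addn0 !subrr mulr0 rnorm0.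
  rewrite addnS -[u _.+1](subrK (u (n + m)%N)) -addrA.
  apply: le_trans (rnormD _ _) _.
  apply: le_trans (lerD (step _) ih) _.
  have q1' : 1 - q != 0 by rewrite subr_eq0 gt_eqF.
  rewrite exprS /K le_eqVlt; apply/orP; left; apply/eqP.
  by field.
have tail e : 0 < e -> exists N, forall n m, (N <= n)%N -> rnorm (u (n + m)%N - u n) < e.
  move=> e0.
  have : q ^+ n @[n --> \oo] --> 0 by apply: cvg_expr; rewrite ger0_norm.
  move=> /cvgrPdist_lt /(_ (e / (K + 1))).
  rewrite divr_gt0//; last by rewrite ltr_wpDl.
  move=> /(_ isT)[N _ hN]; exists N => n m Nn.
  have := hN n Nn; rewrite sub0r normrN ger0_norm ?exprn_ge0// => qn.
  apply: le_lt_trans (far _ _) _.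
  apply: (@le_lt_trans _ _ ((K + 1) * q ^+ n)).
    rewrite ler_pM ?lerDl//; first by rewrite subr_ge0 exprD ler_piMr ?exprn_ge0// exprn_ile1// ltW.
    by rewrite lerBlDr lerDl exprn_ge0.
  by rewrite mulrC -ltr_pdivlMr// ltr_wpDl.
have [l hl] : exists l, forall e : R, 0 < e -> exists N, forall n, (N <= n)%N ->
    rnorm (u n - l) < e.
  apply: rnorm_complete => e e0.
  have [N hN] := tail _ (divr_gt0 e0 (ltr0Sn _ 1)); exists N => m n Nm Nn.
  rewrite -[u m](subrK (u N)) -addrA; apply: le_lt_trans (rnormD _ _) _.
  rewrite (splitr e) ltrD//; first by rewrite -(subnKC Nm) hN.
  by rewrite rdistC -(subnKC Nn) hN.
have Dl : D l.
  apply: cD => e e0; have [N hN] := hl _ e0; exists (u N) => //.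
  by rewrite rdistC hN.
exists l => //; apply/eqP; rewrite -subr_eq0; apply/eqP/rnorm_eq0/eqP.
rewrite eq_le rnorm_ge0 andbT; apply/ler_addgt0Pr => e e0; rewrite add0r.
have [N hN] := hl _ (divr_gt0 e0 (ltr0Sn _ 1)).
rewrite -[F l](subrK (u N.+1)) -addrA; apply: le_trans (rnormD _ _) _.
rewrite (splitr e) lerD ?ltW//; last by rewrite hN.
apply: le_lt_trans (ctr _ _ Dl (Du N)) _.
apply: (@le_lt_trans _ _ (rnorm (l - u N))); first by rewrite ler_piMl ?rnorm_ge0// ltW.
by rewrite rdistC hN.
Qed.
End Complete.

Section CstarBasics.
Local Open Scope complex_scope.
Variables (R : realType) (A : cstarAlgType R).
Implicit Types (x y p : A).
Local Notation "x ** y" := (cmul x y) (at level 40, left associativity).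

Lemma cmulr0 x : x ** 0 = 0.
Proof. by apply: (addrI (x ** 0)); rewrite -cmulDr !addr0. Qed.
Lemma cmul0r x : 0 ** x = 0.
Proof. by apply: (addrI (0 ** x)); rewrite -cmulDl !addr0. Qed.
Lemma cmulrN x y : x ** (- y) = - (x ** y).
Proof. by apply: (addrI (x ** y)); rewrite -cmulDr !subrr cmulr0. Qed.
Lemma cmulNr x y : (- x) ** y = - (x ** y).
Proof. by apply: (addrI (x ** y)); rewrite -cmulDl !subrr cmul0r. Qed.
Lemma cmulBr x y z : x ** (y - z) = x ** y - x ** z.
Proof. by rewrite cmulDr cmulrN. Qed.
Lemma cmulBl x y z : (y - z) ** x = y ** x - z ** x.
Proof. by rewrite cmulDl cmulNr. Qed.
Lemma cmul_sumr x (I : Type) (s : seq I) (P : pred I) (F : I -> A) :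
  x ** (\sum_(i <- s | P i) F i) = \sum_(i <- s | P i) x ** F i.
Proof. by apply: (big_morph (cmul x)) => [y z|]; rewrite ?cmulDr ?cmulr0. Qed.
Lemma cmul_suml x (I : Type) (s : seq I) (P : pred I) (F : I -> A) :
  (\sum_(i <- s | P i) F i) ** x = \sum_(i <- s | P i) F i ** x.
Proof.
by apply: (big_morph (fun y => y ** x)) => [y z|]; rewrite ?cmulDl ?cmul0r.
Qed.

Lemma cstar0 : cstar (0 : A) = 0.
Proof. by apply: (addrI (cstar 0)); rewrite -cstarD !addr0. Qed.
Lemma cstarN x : cstar (- x) = - cstar x.
Proof. by apply: (addrI (cstar x)); rewrite -cstarD !subrr cstar0. Qed.
Lemma cstarB x y : cstar (x - y) = cstar x - cstar y.
Proof. by rewrite cstarD cstarN. Qed.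
Lemma cstar_sum (I : Type) (s : seq I) (P : pred I) (F : I -> A) :
  cstar (\sum_(i <- s | P i) F i) = \sum_(i <- s | P i) cstar (F i).
Proof. by apply: (big_morph (@cstar R A)) => [y z|]; rewrite ?cstarD ?cstar0. Qed.

Lemma rnormM x y : rnorm (x ** y) <= rnorm x * rnorm y.
Proof. by rewrite -lecR rmorphM /= -!rnormE cnorm_mul. Qed.

Lemma rnorm_starM x : rnorm (cstar x ** x) = rnorm x ^+ 2.
Proof. by apply: (@complexI R); rewrite rmorphXn /= -!rnormE cnorm_star. Qed.

Lemma rnorm_star x : rnorm (cstar x) = rnorm x.
Proof.
have H y : rnorm y <= rnorm (cstar y).
  have := rnorm_starM y; have := rnormM (cstar y) y.
  have := rnorm_ge0 y; rewrite le_eqVlt => /predU1P[<-|y0].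
    by rewrite rnorm_ge0.
  by move=> h1 h2; rewrite -(ler_pM2r y0) -expr2 -h2.
by apply/eqP; rewrite eq_le H andbT -{2}(cstarK x) H.
Qed.

Lemma starM_eq0 x : cstar x ** x = 0 -> x = 0.
Proof.
move=> h; apply: rnorm_eq0; apply/eqP; rewrite -sqrf_eq0 -rnorm_starM h.
by rewrite rnorm0.
Qed.

Lemma rnorm_proj p : projection p -> rnorm p <= 1.
Proof.
move=> [pp ps]; have := rnorm_starM p; rewrite ps pp => h.
have := rnorm_ge0 p; rewrite le_eqVlt => /predU1P[<-//|p0].
by rewrite -(ler_pM2r p0) -expr2 -h mul1r.
Qed.

End CstarBasics.

(** * Square roots in an algebra without unit *)

Section SquareRoot.
Local Open Scope complex_scope.
Variables (R : realType) (A : cstarAlgType R).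
Local Notation "x ** y" := (cmul x y) (at level 40, left associativity).

(** The last equation is [(1 - g)^2 = 1 - b^2] with the unit cancelled. Its solution is a fixed
    point of [g |-> (b^2 + g^2) / 2] on the self-adjoint elements of norm at most [q = rnorm b]
    commuting with [b]: since [q < 1] this set is mapped into itself, and the map contracts by
    [q]. *)
Lemma half_sqrt (b : A) : cstar b = b -> rnorm b < 1 ->
  exists g, [/\ cstar g = g, g ** b = b ** g & g + g = b ** b + g ** g].
Proof.
move=> bs b1; set q := rnorm b.
have q0 : 0 <= q := rnorm_ge0 _.
pose D := [set g : A | [/\ cstar g = g, g ** b = b ** g & rnorm g <= q]].
have h2 : (2^-1 : R[i]) = (2^-1 : R)%:C by rewrite fmorphV rmorph_nat.
have rh2 (x : A) : rnorm (2^-1 *: x) = 2^-1 * rnorm x.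
  by rewrite rnormZ h2 ger0_norm// ler0c invr_ge0.
have [] := @rnorm_fixpoint R A D (fun g => 2^-1 *: (b ** b + g ** g)) q 0.
- by rewrite q0.
- move=> x hx; split.
  + apply/eqP; rewrite -subr_eq0; apply/eqP/rnorm_eq0/eqP.
    rewrite eq_le rnorm_ge0 andbT; apply/ler_addgt0Pr => e e0; rewrite add0r.
    have [y [ys _ _] xy] := hx _ (divr_gt0 e0 (ltr0Sn _ 1)).
    have -> : cstar x - x = cstar (x - y) - (x - y).
      by rewrite cstarB ys opprB addrA subrK.
    by apply: le_trans (rnormB _ _) _; rewrite rnorm_star (splitr e) lerD ?ltW.
  + apply/eqP; rewrite -subr_eq0; apply/eqP/rnorm_eq0/eqP.
    rewrite eq_le rnorm_ge0 andbT; apply/ler_addgt0Pr => e e0; rewrite add0r.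
    have [y [_ yb _] xy] := hx _ (divr_gt0 e0 (ltr0Sn _ 1)).
    have -> : x ** b - b ** x = (x - y) ** b - b ** (x - y).
      by rewrite cmulBl cmulBr yb opprB addrA subrK.
    apply: le_trans (rnormB _ _) _; rewrite (splitr e) lerD//.
      apply: le_trans (rnormM _ _) _; apply: le_trans (ltW xy).
      by rewrite ler_piMr ?rnorm_ge0// ltW.
    apply: le_trans (rnormM _ _) _; apply: le_trans (ltW xy).
    by rewrite ler_piMl ?rnorm_ge0// ltW.
  + apply/ler_addgt0Pr => e e0; have [y [_ _ yq] xy] := hx _ e0.
    have := rnormD (x - y) y; rewrite subrK => /le_trans; apply.
    by rewrite addrC lerD // ltW.
- by split; rewrite ?cstar0 ?cmulr0 ?cmul0r ?rnorm0.
- move=> g [gs gb gq]; split.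
  + rewrite cstarZ cstarD !cstarM bs gs; congr (_ *: _).
    by rewrite h2 conj_Creal// complex_real.
  + rewrite cmulZl cmulZr cmulDl cmulDr cmulA; congr (_ *: (_ + _)).
    by rewrite -cmulA gb cmulA gb -cmulA.
  + rewrite rh2 ler_pdivrMl//; apply: le_trans (rnormD _ _) _.
    apply: le_trans (lerD (rnormM _ _) (rnormM _ _)) _.
    rewrite mulr2n mulrDl mul1r lerD//; first by rewrite ler_piMl// ltW.
    rewrite (le_trans _ gq)// ler_piMl ?rnorm_ge0// (le_trans gq)// ltW//.
- move=> x y [_ _ xq] [_ _ yq]; rewrite -scalerBr rh2.
  have -> : b ** b + x ** x - (b ** b + y ** y) = x ** (x - y) + (x - y) ** y.
    by rewrite cmulBl cmulBr addrA subrK opprD addrACA subrr add0r.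
  rewrite ler_pdivrMl//; apply: le_trans (rnormD _ _) _.
  apply: le_trans (lerD (rnormM _ _) (rnormM _ _)) _.
  rewrite [rnorm (x - y) * _]mulrC -mulrDl mulrA ler_wpM2r ?rnorm_ge0//.
  by rewrite mulr2n mulrDl mul1r lerD.
move=> g [gs gb gq] gE; exists g; split => //.
have h22 : 2^-1 + 2^-1 = 1 :> R[i] by rewrite [RHS]splitr mul1r.
by rewrite -{1 2}gE -scalerDl h22 scale1r.
Qed.

End SquareRoot.

(** * Contractivity of star-homomorphisms *)

Section Morphisms.
Local Open Scope complex_scope.
Variables (R : realType) (A B : cstarAlgType R) (f : A -> B).
Hypothesis hf : star_hom f.
Local Notation "x ** y" := (cmul x y) (at level 40, left associativity).

Lemma star_hom0 : f 0 = 0.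
Proof. by apply: (addrI (f 0)); rewrite -(star_homD hf) !addr0. Qed.
Lemma star_homN x : f (- x) = - f x.
Proof. by apply: (addrI (f x)); rewrite -(star_homD hf) !subrr star_hom0. Qed.
Lemma star_homB x y : f (x - y) = f x - f y.
Proof. by rewrite (star_homD hf) star_homN. Qed.

(* Up to a unit, [b] is the mean of [U] and [U^-1] for the unitary [U = b + i (1 - g)] with
   [(1 - g)^2 = 1 - b^2]; unitaries are mapped to unitaries, which act
   isometrically by multiplication. *)
Lemma star_hom_selfadj (b : A) : cstar b = b -> rnorm b < 1 -> rnorm (f b) <= 1.
Proof.
move=> bs b1; have [g [gs gb gE]] := half_sqrt bs b1.
set d := f b; set k := f g.
have ds : cstar d = d by rewrite -(star_homS hf) bs.
have ks : cstar k = k by rewrite -(star_homS hf) gs.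
have kd : k ** d = d ** k by rewrite -!(star_homM hf) gb.
have kE : k + k = d ** d + k ** k.
  by rewrite -!(star_homM hf) -!(star_homD hf) gE.
(* Left multiplication by [d + s (1 - k)]. For [s = i] this is the image of the unitary, for
   [s = - i] its adjoint, and the two add up to twice the multiplication by [d]. *)
pose V (s : R[i]) (w : B) := d ** w + s *: (w - k ** w).
have Viso s (w : B) : (s^* )%R = - s -> s * s = -1 -> rnorm (V s w) = rnorm w.
  move=> ss sq; apply/eqP; rewrite -(eqrXn2 (ltn0Sn 1)) ?rnorm_ge0//.
  rewrite -!rnorm_starM /V; set W := w - k ** w; apply/eqP; congr (rnorm _).
  have Ws : cstar W = cstar w - cstar w ** k by rewrite cstarB cstarM ks.
  have WW : cstar W ** W = cstar w ** w - cstar w ** d ** (d ** w).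
    have -> : cstar W ** W = cstar w ** (W - k ** W).
      by rewrite Ws cmulBl cmulBr cmulA.
    rewrite -cmulA -cmulBr; congr (_ ** _).
    have -> : d ** (d ** w) = k ** w + k ** w - k ** (k ** w).
      by rewrite -cmulDl kE cmulDl -!cmulA addrK.
    by rewrite cmulBr !opprD opprK !addrA.
  have Wd : cstar W ** (d ** w) = cstar w ** d ** W.
    by rewrite Ws cmulBl cmulBr !cmulA -(cmulA _ k d) kd !cmulA.
  rewrite cstarD cstarZ ss cstarM ds cmulDl !cmulDr !cmulZl !cmulZr scalerA.
  rewrite mulNr sq opprK scale1r WW Wd scaleNr.
  by rewrite addrA addrK addrC subrK.
pose i : R[i] := ('i)%R.
have i2 : i * i = -1 by rewrite -expr2 sqrCi.
have ij : (i^* )%R = - i by rewrite conjCi.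
have dle (w : B) : rnorm (d ** w) <= rnorm w.
  have : d ** w + d ** w = V i w + V (- i) w.
    by rewrite /V scaleNr addrACA subrr addr0.
  move=> /(congr1 (@rnorm R B)); rewrite -mulr2n -scaler_nat rnormZ normr_nat.
  have -> : complex.Re (2%:R : R[i]) = 2 by rewrite -(rmorph_nat (real_complex R)).
  move=> e; have := rnormD (V i w) (V (- i) w); rewrite -e.
  by rewrite !Viso ?mulrNN ?rmorphN/= ?ij// -mulr2n mulr_natl ler_pMn2r.
(* At [w = d] the C*-identity turns the bound into [rnorm d ^+ 2 <= rnorm d]. *)
have := dle d; rewrite -{1}ds rnorm_starM.
have := rnorm_ge0 d; rewrite le_eqVlt => /predU1P[<-//|d0].
by rewrite expr2 ger_pMl.
Qed.

(** On the open unit ball the C*-identity reduces the bound to the self-adjoint element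
    [cstar y ** y]. Dividing by [rnorm x + e] instead of [rnorm x] makes the norm strictly less than
    1 and covers [x = 0]. *)
Theorem star_hom_contractive (x : A) : rnorm (f x) <= rnorm x.
Proof.
have unit_ball y : rnorm y < 1 -> rnorm (f y) <= 1.
  move=> y1; have := @star_hom_selfadj (cstar y ** y).
  rewrite cstarM cstarK => /(_ erefl).
  rewrite (star_homM hf) (star_homS hf) !rnorm_starM => h.
  by rewrite -(@expr_le1 _ 2) ?rnorm_ge0// h// expr_lt1 ?rnorm_ge0.
apply/ler_addgt0Pr => e e0.
have t0 : 0 < rnorm x + e by rewrite ltr_wpDl ?rnorm_ge0.
have scale (C : cstarAlgType R) (y : C) :
    rnorm ((rnorm x + e)^-1%:C *: y) = (rnorm x + e)^-1 * rnorm y.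
  by rewrite rnormZ ger0_norm// ler0c invr_ge0 ltW.
have := unit_ball ((rnorm x + e)^-1%:C *: x).
rewrite (star_homZ hf) !scale ler_pdivrMl// mulr1; apply.
by rewrite ltr_pdivrMl// mulr1 ltrDl.
Qed.

Lemma star_hom_ker_ideal : closed_ideal [set x | f x = 0].
Proof.
split => /=.
- exact: star_hom0.
- by move=> x y; rewrite (star_homD hf) => -> ->; rewrite addr0.
- by move=> a x; rewrite (star_homZ hf) => ->; rewrite scaler0.
- by move=> x y; rewrite (star_homM hf) => ->; rewrite cmulr0.
- by move=> x y; rewrite (star_homM hf) => ->; rewrite cmul0r.
- move=> x hx; apply: rnorm_eq0; apply/eqP; rewrite eq_le rnorm_ge0 andbT.
  apply/ler_addgt0Pr => e e0; rewrite add0r.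
  have e0' : 0 < e%:C :> R[i] by rewrite ltcR.
  have [y [/= fy xy]] := hx _ (nbhsx_ballx x _ e0').
  move: xy; rewrite -ball_normE /ball_ /= rnormE ltcR => xy.
  rewrite -[f x]subr0 -fy -star_homB.
  by rewrite (le_trans (star_hom_contractive _))// ltW.
Qed.

End Morphisms.

(** * Projections close to a closed ideal *)

Section Ideals.
Local Open Scope complex_scope.
Variables (R : realType) (A : cstarAlgType R) (I : set A).
Hypothesis hI : closed_ideal I.
Local Notation "x ** y" := (cmul x y) (at level 40, left associativity).

Lemma ideal_sum (T : Type) (s : seq T) (P : pred T) (F : T -> A) :
  (forall i, P i -> I (F i)) -> I (\sum_(i <- s | P i) F i).
Proof.
by move=> h; apply: big_ind => //; [exact: (ideal0 hI)|exact: (idealD hI)].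
Qed.

(* The powers of [c = p - p y p] tend to [0] and are equal to [p] modulo [I]. *)
Lemma projection_near_ideal p y :
  projection p -> I y -> rnorm (p - y) < 1 -> I p.
Proof.
move=> pP Iy py; have [pp ps] := pP.
pose c := p - p ** y ** p.
have pc : p ** c = c by rewrite /c cmulBr !cmulA !pp.
have c1 : rnorm c <= rnorm (p - y).
  have -> : c = p ** (p - y) ** p by rewrite cmulBr cmulBl !pp.
  have p1 := rnorm_proj pP.
  apply: le_trans (rnormM _ _) _; rewrite -[leRHS]mulr1 ler_pM ?rnorm_ge0//.
  by apply: le_trans (rnormM _ _) _; rewrite -[leRHS]mul1r ler_wpM2r ?rnorm_ge0.
(* [u n] is the power of [c] with exponent [n + 1]; the powers start at [c] as there is no unit. *)
pose u n := iter n (fun z => z ** c) c.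
have uI n : I (p - u n).
  have pcI : I (p - c).
    by rewrite /c opprB addrC subrK; apply: (Defs.idealMr hI); apply: (idealMl hI).
  elim: n => [//|n ih] /=; have -> : p - u n ** c = (p - u n) ** c + (p - c).
    by rewrite cmulBl pc [RHS]addrC addrA subrK.
  by apply: (idealD hI) => //; apply: (Defs.idealMr hI).
have un n : rnorm (u n) <= rnorm (p - y) ^+ n.+1.
  elim: n => [|n ih]; first by rewrite expr1.
  apply: le_trans (rnormM _ _) _; rewrite exprSr.
  by rewrite ler_pM ?rnorm_ge0.
apply: closed_rnorm; first exact: ideal_closed.
move=> e e0.
have : rnorm (p - y) ^+ n @[n --> \oo] --> 0.
  by apply: cvg_expr; rewrite ger0_norm ?rnorm_ge0.
move=> /cvgrPdist_lt /(_ _ e0)[N _ hN].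
exists (p - u N) => //; rewrite opprB addrC subrK.
apply: le_lt_trans (un N) _.
have := hN N.+1 (leqnSn N).
by rewrite /= sub0r normrN ger0_norm ?exprn_ge0 ?rnorm_ge0.
Qed.

End Ideals.

(** * Spectral decomposition in finite-dimensional algebras *)

Section Spectral.
Local Open Scope complex_scope.
Variables (R : realType) (A : cstarAlgType R) (a : A).
Hypothesis a_sa : cstar a = a.
Local Notation "x ** y" := (cmul x y) (at level 40, left associativity).
Implicit Types (x y w : A) (z : R[i]) (t : R).

Lemma conj_real t : ((t%:C)^* )%R = t%:C :> R[i].
Proof. by rewrite conj_Creal// complex_real. Qed.

(** Left multiplication by [a - z], an operator on [A] that need not come from an element of [A]. *)
Let shift z y := a ** y - z *: y.

Let shiftB z x y : shift z (x - y) = shift z x - shift z y.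
Proof. by rewrite /shift cmulBr scalerBr !opprD addrACA. Qed.

Lemma shift_sum z (s : seq R) (Y : R -> A) :
  shift z (\sum_(t <- s) Y t) = \sum_(t <- s) shift z (Y t).
Proof. by rewrite /shift cmul_sumr scaler_sumr sumrB. Qed.

(** Evaluating [cstar w ** a ** w] from the right gives the factor [z], from the left its
    conjugate. *)
Lemma eigen_nonreal z w : z \isn't Num.real -> shift z w = 0 -> w = 0.
Proof.
move=> zr /eqP; rewrite subr_eq0 => /eqP aw; apply: starM_eq0.
have e1 : cstar w ** (a ** w) = z *: (cstar w ** w) by rewrite aw cmulZr.
have e2 : cstar w ** (a ** w) = (z^* )%R *: (cstar w ** w).
  by rewrite cmulA -{1}a_sa -cstarM aw cstarZ cmulZl.
have : (z - (z^* )%R) *: (cstar w ** w) = 0 by rewrite scalerBl -e1 -e2 subrr.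
move=> /eqP; rewrite scaler_eq0 => /orP[|/eqP//].
by rewrite subr_eq0 eq_sym -CrealE (negPf zr).
Qed.

(** There are no Jordan blocks: as [a - t] is self-adjoint for real [t], the square of the norm of
    [(a - t) w] is the norm of [cstar w ** (a - t)^2 w]. *)
Lemma eigen_semisimple t w : shift t%:C (shift t%:C w) = 0 -> shift t%:C w = 0.
Proof.
move=> h; apply: starM_eq0.
have -> : cstar (shift t%:C w) = cstar w ** a - t%:C *: cstar w.
  by rewrite /shift cstarB cstarM cstarZ a_sa conj_real.
by rewrite cmulBl -cmulA cmulZl -cmulZr -cmulBr -/(shift _ _) h cmulr0.
Qed.

(** By induction [(a - z) y] is a sum of eigenvectors. Components with eigenvalue [t] other than [z]
    are lifted through [a - z] by dividing by [t - z]; once these lifts are subtracted from [y], the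
    remainder [w] satisfies [(a - z)^2 w = 0]. For real [z] it is then an eigenvector, and for
    non-real [z] it vanishes. *)
Lemma spectral_split (r : seq R[i]) y : foldl (fun w z => shift z w) y r = 0 ->
  exists s : seq R, exists Y : R -> A,
  [/\ uniq s, y = \sum_(t <- s) Y t & forall t, t \in s -> a ** Y t = t%:C *: Y t].
Proof.
elim: r y => [|z r ih] y /=.
  by move=> ->; exists [::], (fun=> 0); rewrite big_nil.
move=> /ih[s [Y [us yE sY]]].
pose s' := [seq t <- s | t%:C != z].
pose Y' t := (t%:C - z)^-1 *: Y t.
pose w := y - \sum_(t <- s') Y' t.
have us' : uniq s' by rewrite filter_uniq.
have sY' t : t \in s' -> a ** Y' t = t%:C *: Y' t.
  by rewrite mem_filter => /andP[_ ts]; rewrite cmulZr sY// !scalerA mulrC.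
have yw : y = w + \sum_(t <- s') Y' t by rewrite subrK.
have sw : shift z w = \sum_(t <- s | t%:C == z) Y t.
  rewrite shiftB yE shift_sum (bigID (fun t => t%:C == z))/= big_filter.
  rewrite -[RHS]addr0 -addrA; congr (_ + _); apply/eqP; rewrite subr_eq0; apply/eqP.
  rewrite big_seq_cond [RHS]big_seq_cond; apply: eq_bigr => t /andP[ts tz].
  rewrite /shift cmulZr sY// !scalerA -scalerBl mulrC -mulrBl mulfV ?scale1r//.
  by rewrite subr_eq0.
have [zR|zR] := boolP (z \is Num.real); last first.
  have w0 : w = 0.
    apply: (eigen_nonreal zR); rewrite -/(shift _ _) sw big1 // => t /eqP tz.
    by move: zR; rewrite -tz complex_real eqxx.
  by exists s', Y'; split => //; rewrite yw w0 add0r.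
have [x xz] : exists x : R, z = x%:C by have /complex_realP[x ->] := zR; exists x.
exists (x :: s'), (fun t => if t == x then w else Y' t); split => /=.
- by rewrite us' andbT mem_filter xz eqxx.
- rewrite big_cons eqxx {1}yw; congr (_ + _); apply: eq_big_seq => t.
  by rewrite mem_filter xz (inj_eq (@complexI R)) => /andP[/negPf -> _].
- move=> t; rewrite in_cons; have [-> _|_ /=] := eqVneq t x; last exact: sY'.
  apply/eqP; rewrite -subr_eq0; apply/eqP; apply: eigen_semisimple.
  rewrite -xz sw -[X in shift z X]big_filter shift_sum big1_seq // => u /=.
  rewrite mem_filter => /andP[/eqP uz us0].
  by rewrite /shift sY// uz subrr.
Qed.

(** [p(a) y], for [N] at least the size of [p]. A polynomial acts on [y] because its constant term
    has no value in [A]. *)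
Let act (N : nat) (p : {poly R[i]}) y := \sum_(i < N) p`_i *: iter i (cmul a) y.

Let actS N p y : act N.+1 p y = p`_0 *: y + \sum_(i < N) p`_i.+1 *: iter i (cmul a) (a ** y).
Proof.
rewrite /act big_ord_recl; congr (_ + _); apply: eq_bigr => i _.
by rewrite -iterSr.
Qed.

Lemma act_shift N z (p : {poly R[i]}) y : (size p <= N)%N ->
  act N.+1 (('X - z%:P) * p) y = act N p (shift z y).
Proof.
move=> pN.
have -> : act N.+1 (('X - z%:P) * p) y =
    act N.+1 ('X * p) y - z *: act N.+1 p y.
  rewrite /act scaler_sumr -sumrB; apply: eq_bigr => i _.
  by rewrite mulrBl coefB coefCM scalerBl scalerA.
have -> : act N.+1 p y = act N p y.
  by rewrite /act big_ord_recr /= nth_default // scale0r addr0.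
rewrite actS coefXM /= scale0r add0r.
have iterB i x w : iter i (cmul a) (x - w) = iter i (cmul a) x - iter i (cmul a) w.
  by elim: i => //= i ->; rewrite cmulBr.
have iterZ i (c : R[i]) x : iter i (cmul a) (c *: x) = c *: iter i (cmul a) x.
  by elim: i => //= i ->; rewrite cmulZr.
rewrite /act scaler_sumr -sumrB; apply: eq_bigr => i _.
by rewrite coefXM /= /shift iterB iterZ scalerBr !scalerA mulrC.
Qed.

Lemma act_prod (r : seq R[i]) y :
  act (size r).+1 (\prod_(z <- r) ('X - z%:P)) y =
  foldl (fun w z => shift z w) y r.
Proof.
elim: r y => [|z r ih] y /=.
  by rewrite big_nil /act big_ord1 coefC /= scale1r.
by rewrite big_cons act_shift ?size_prod_XsubC// ih.
Qed.

(** The [n + 1] elements [a, a^2, ..., a^(n + 1)] lie in the span of [n] vectors. A linear relation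
    among them is a non-zero polynomial [p] with [p(a) a = 0], and it splits over the algebraically
    closed field [R[i]]. Starting at [a] instead of the unit keeps all powers inside [F]. *)
Lemma finite_dimensional_annihilator (F : set A) :
  star_subalgebra F -> finite_dimensional F -> F a ->
  exists r : seq R[i], foldl (fun w z => shift z w) a r = 0.
Proof.
move=> hF [n [b hb]] Fa.
have Fi i : F (iter i (cmul a) a) by elim: i => //= i; apply: (subalgM hF).
have [c hc] := choice (fun i => hb _ (Fi i)).
pose M : 'M[R[i]]_(n.+1, n) := \matrix_(i, j) c i j.
have : kermx M != 0.
  rewrite kermx_eq0 /row_free neq_ltn; apply/orP; left.
  by rewrite ltnS rank_leq_col.
move=> /rowV0Pn[v /sub_kermxP vM v0].
pose p := rVpoly v.
have p0 : p != 0.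
  by apply: contra_neq v0 => /(congr1 (@poly_rV _ n.+1)); rewrite rVpolyK linear0.
have actp : act n.+1 p a = 0.
  rewrite /act; under eq_bigr do rewrite coef_rVpoly_ord hc scaler_sumr.
  rewrite exchange_big /= big1 // => j _.
  under eq_bigr do rewrite scalerA.
  rewrite -scaler_suml.
  have := congr1 (fun u : 'rV_n => u 0 j) vM; rewrite !mxE => e.
  suff -> : \sum_(i < n.+1) v 0 i * c i j = 0 by rewrite scale0r.
  by rewrite -[RHS]e; apply: eq_bigr => i _; rewrite mxE.
have [r pr] := closed_field_poly_normal p.
have lc : lead_coef p != 0 by rewrite lead_coef_eq0.
have szr : size p = (size r).+1 by rewrite pr size_scale// size_prod_XsubC.
exists r; rewrite -act_prod.
have : act (size r).+1 p a = 0.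
  rewrite -actp -szr /act; have szp : (size p <= n.+1)%N := size_poly _ _.
  rewrite (big_ord_widen_cond _ predT (fun i => p`_i *: iter i (cmul a) a) szp).
  rewrite big_mkcond; apply: eq_bigr => i _ /=; case: ltnP => // h.
  by rewrite nth_default// scale0r.
have -> : act (size r).+1 p a = lead_coef p *: act (size r).+1 (\prod_(z <- r) ('X - z%:P)) a.
  rewrite {1}pr /act scaler_sumr; apply: eq_bigr => i _.
  by rewrite coefZ scalerA.
by move=> /eqP; rewrite scaler_eq0 (negPf lc) => /eqP.
Qed.

(** Eigenvectors [Y t] of the self-adjoint [a] for distinct eigenvalues are orthogonal. Since their
    sum is [a] itself, [cstar (Y t) ** Y t = cstar (Y t) ** a = t cstar (Y t)]; hence for [t]
    non-zero [Y t] is self-adjoint and [Y t / t] is a projection. *)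
Theorem spectral_decomposition (F : set A) :
  star_subalgebra F -> finite_dimensional F -> F a ->
  exists (s : seq R) (P : R -> A),
  [/\ uniq s, forall t, t \in s -> projection (P t),
      forall t u, t \in s -> u \in s -> t != u -> P t ** P u = 0 &
      a = \sum_(t <- s) t%:C *: P t].
Proof.
move=> hF dF Fa; have [r /spectral_split] := finite_dimensional_annihilator hF dF Fa.
move=> [s [Y [us aE sY]]].
have sYs t : t \in s -> cstar (Y t) ** a = t%:C *: cstar (Y t).
  by move=> ts; rewrite -{1}a_sa -cstarM sY// cstarZ conj_real.
have orth t u : t \in s -> u \in s -> t != u -> cstar (Y t) ** Y u = 0.
  move=> ts us' tu.
  have e1 : cstar (Y t) ** (a ** Y u) = u%:C *: (cstar (Y t) ** Y u).
    by rewrite sY// cmulZr.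
  have e2 : cstar (Y t) ** (a ** Y u) = t%:C *: (cstar (Y t) ** Y u).
    by rewrite cmulA sYs// cmulZl.
  have : (t - u)%:C *: (cstar (Y t) ** Y u) = 0.
    by rewrite rmorphB scalerBl -e1 -e2 subrr.
  move=> /eqP; rewrite scaler_eq0 => /orP[|/eqP//].
  by rewrite (inj_eq (@complexI R) _ 0) subr_eq0 (negPf tu).
have YY t : t \in s -> cstar (Y t) ** Y t = t%:C *: cstar (Y t).
  move=> ts; rewrite -sYs// {1}aE cmul_sumr (bigD1_seq t)//=.
  rewrite big1_seq ?addr0// => u /andP[ut us']; apply: orth => //.
  by rewrite eq_sym.
have Ysa t : t \in s -> t != 0 -> cstar (Y t) = Y t.
  move=> ts t0; have := congr1 (@cstar R A) (YY t ts).
  rewrite cstarM cstarK YY// cstarZ conj_real cstarK => /eqP.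
  rewrite -subr_eq0 -scalerBr scaler_eq0 (inj_eq (@complexI R) _ 0) (negPf t0).
  by rewrite subr_eq0 => /eqP.
exists [seq t <- s | t != 0], (fun t => t^-1%:C *: Y t); split.
- by rewrite filter_uniq.
- move=> t; rewrite mem_filter => /andP[t0 ts]; split.
    rewrite cmulZl cmulZr -{1}Ysa// YY// Ysa// !scalerA -!rmorphM /=.
    by rewrite -mulrA mulVf// mulr1.
  by rewrite cstarZ conj_real Ysa.
- move=> t u; rewrite !mem_filter => /andP[t0 ts] /andP[u0 us'] tu.
  by rewrite cmulZl cmulZr -{1}Ysa// orth// !scaler0.
rewrite {1}aE big_filter (bigID (fun t => t != 0)) /= [X in _ + X]big1_seq ?addr0.
  apply: eq_bigr => t t0.
  by rewrite scalerA -rmorphM /= mulfV// scale1r.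
(* The component with eigenvalue 0 vanishes, because [cstar (Y 0) ** Y 0] is 0 times
   [cstar (Y 0)]. *)
move=> t /andP[]; rewrite negbK => /eqP -> ts; apply: starM_eq0.
by rewrite YY// scale0r.
Qed.

End Spectral.

(** * Ideals of AF algebras *)

Section OrthogonalProjections.
Local Open Scope complex_scope.
Variables (R : realType) (A : cstarAlgType R).
Local Notation "x ** y" := (cmul x y) (at level 40, left associativity).

Variables (s : seq R) (P : R -> A).
Hypotheses (us : uniq s) (projP : forall t, t \in s -> projection (P t))
  (orthP : forall t u, t \in s -> u \in s -> t != u -> P t ** P u = 0).

Lemma orth_comb_mul (a b : R -> R[i]) :
  (\sum_(t <- s) a t *: P t) ** (\sum_(t <- s) b t *: P t) =
  \sum_(t <- s) (a t * b t) *: P t.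
Proof.
rewrite cmul_suml big_seq [RHS]big_seq; apply: eq_bigr => t ts.
rewrite cmul_sumr (bigD1_seq t)//= big1_seq ?addr0 => [|u /andP[ut us']].
  by rewrite cmulZl cmulZr scalerA (projP ts).1.
by rewrite cmulZl cmulZr orthP 1?eq_sym// !scaler0.
Qed.

Lemma orth_comb_star (a : R -> R[i]) :
  cstar (\sum_(t <- s) a t *: P t) = \sum_(t <- s) ((a t)^* )%R *: P t.
Proof.
rewrite cstar_sum big_seq [RHS]big_seq; apply: eq_bigr => t ts.
by rewrite cstarZ (projP ts).2.
Qed.

Lemma orth_comb_unit (a : R -> R[i]) : (forall t, t \in s -> `|a t| = 1) ->
  rnorm (\sum_(t <- s) a t *: P t) <= 1.
Proof.
move=> a1; rewrite -(@expr_le1 _ 2) ?rnorm_ge0// -rnorm_starM.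
rewrite orth_comb_star orth_comb_mul.
have -> : \sum_(t <- s) ((a t)^* * a t)%R *: P t = \sum_(t <- s) (1 : R[i]) *: P t.
  rewrite big_seq [RHS]big_seq; apply: eq_bigr => t ts.
  by rewrite mulrC -normCK a1// expr1n.
apply: rnorm_proj; split.
  by rewrite orth_comb_mul; under eq_bigr do rewrite mulr1.
by rewrite orth_comb_star; under eq_bigr do rewrite conjC1.
Qed.

(* [t P] with [`|t| <= e] is [e / 2] times the sum of two conjugate unimodular
   multiples of [P]. *)
Lemma orth_comb_bound (e : R) : 0 < e -> (forall t, t \in s -> `|t| <= e) ->
  rnorm (\sum_(t <- s) t%:C *: P t) <= e.
Proof.
move=> e0 se.
pose u t : R[i] := Complex (t / e) (Num.sqrt (1 - (t / e) ^+ 2)).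
have te t : t \in s -> (t / e) ^+ 2 <= 1.
  move=> /se h; rewrite -real_normK ?num_real// expr_le1//.
  by rewrite normrM normfV (gtr0_norm e0) ler_pdivrMr// mul1r.
have u1 t : t \in s -> `|u t| = 1.
  move=> ts; rewrite normc_def /= sqr_sqrtr ?subr_ge0 ?te//.
  by rewrite addrC subrK sqrtr1.
have u1' t : t \in s -> `|((u t)^* )%R| = 1 by move=> ts; rewrite norm_conjC u1.
have -> : \sum_(t <- s) t%:C *: P t =
    (e / 2)%:C *: (\sum_(t <- s) u t *: P t + \sum_(t <- s) ((u t)^* )%R *: P t).
  rewrite -big_split scaler_sumr; apply: eq_bigr => t _ /=.
  rewrite -scalerDl scalerA; congr (_ *: _).
  apply/eqP; rewrite eq_complex /=; apply/andP; split; apply/eqP; last by ring.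
  field; by rewrite gt_eqF.
have e2 : 0 <= e / 2 by rewrite divr_ge0 ?(ltW e0).
rewrite rnormZ ger0_norm ?ler0c//=.
have := rnormD (\sum_(t <- s) u t *: P t) (\sum_(t <- s) ((u t)^* )%R *: P t).
have := orth_comb_unit u1; have := orth_comb_unit u1'.
set n1 := rnorm _; set n2 := rnorm _; set n3 := rnorm _ => h1 h2 h3.
apply: (@le_trans _ _ (e / 2 * 2)); last by rewrite divfK.
by rewrite ler_wpM2l//; lra.
Qed.

End OrthogonalProjections.

Section IdealsOfAF.
Local Open Scope complex_scope.
Variables (R : realType) (A : cstarAlgType R).
Local Notation "x ** y" := (cmul x y) (at level 40, left associativity).

Lemma AF_approx_selfadj (h : A) (e : R) : is_AF A -> cstar h = h -> 0 < e ->
  exists (F : set A) (a : A), [/\ star_subalgebra F, finite_dimensional F, F a,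
    cstar a = a & rnorm (h - a) < e].
Proof.
move=> [F [sF dF _ clF]] hs e0.
have e0' : 0 < e%:C :> R[i] by rewrite ltcR.
have : closure (\bigcup_n F n) h by rewrite clF.
move=> /(_ _ (nbhsx_ballx h _ e0'))[a0 [[n _ Fa0]]].
rewrite -ball_normE /ball_ /= rnormE ltcR => ha0.
pose a := (2^-1 : R)%:C *: (a0 + cstar a0).
exists (F n), a; split => //.
- apply: (subalgZ (sF n)); apply: (subalgD (sF n)) => //.
  exact: (subalgS (sF n)).
- by rewrite /a cstarZ conj_real cstarD cstarK addrC.
have -> : h - a = (2^-1 : R)%:C *: ((h - a0) + cstar (h - a0)).
  have half : 2^-1 + 2^-1 = 1 :> R by rewrite [RHS]splitr mul1r.
  rewrite cstarB hs addrACA -opprD scalerBr; congr (_ - _).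
  by rewrite scalerDr -scalerDl -rmorphD /= half scale1r.
rewrite rnormZ ger0_norm ?ler0c ?invr_ge0//= ltr_pdivrMl//.
apply: le_lt_trans (rnormD _ _) _; rewrite rnorm_star.
by rewrite -mulr2n mulr_natl ltr_pMn2r.
Qed.

Theorem AF_ideal_projection (I : set A) (x : A) (e : R) :
  is_AF A -> closed_ideal I -> I x -> 0 < e ->
  exists p, [/\ projection p, I p & rnorm (x - x ** p) < e].
Proof.
move=> hAF hI Ix e0.
(* The square of the norm of [x - x p] will be bounded by [d] from the small eigenvalues plus [4 d]
   from the error [h - a], each of the two factors [1 - p] costing a factor 2. This leaves
   [5 d < 6 d = e ^+ 2]. *)
pose d := e ^+ 2 / 6.
have d0 : 0 < d by rewrite divr_gt0 ?exprn_gt0.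
pose h := cstar x ** x.
have Ih : I h by apply: (idealMl hI).
have [|F [a [sF dF Fa asa ha]]] := @AF_approx_selfadj h d hAF _ d0.
  by rewrite cstarM cstarK.
have [s [P [us projP orthP aE]]] := spectral_decomposition asa sF dF Fa.
pose s1 := [seq t <- s | d < `|t|]; pose s2 := [seq t <- s | `|t| <= d].
have s1s t : t \in s1 -> t \in s by rewrite mem_filter => /andP[].
have s2s t : t \in s2 -> t \in s by rewrite mem_filter => /andP[].
have projP1 t : t \in s1 -> projection (P t) by move=> /s1s; exact: projP.
have orthP1 t u : t \in s1 -> u \in s1 -> t != u -> P t ** P u = 0.
  by move=> /s1s ts /s1s us'; exact: orthP.
have us1 : uniq s1 by rewrite filter_uniq.
have us2 : uniq s2 by rewrite filter_uniq.
have IP t : t \in s1 -> I (P t).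
  rewrite mem_filter => /andP[dt ts].
  have t0 : 0 < `|t| := lt_trans d0 dt.
  have t0' : t != 0 by rewrite -normr_gt0.
  have Pta : P t ** a = t%:C *: P t.
    rewrite aE cmul_sumr (bigD1_seq t)//= big1_seq ?addr0.
      by rewrite cmulZr (projP t ts).1.
    by move=> u /andP[ut us']; rewrite cmulZr orthP 1?eq_sym// scaler0.
  (* [P t] equals [t^-1 P t a], so its distance from the element [t^-1 P t h] of [I] is at most
     [d / |t|], which is less than 1. *)
  apply: (projection_near_ideal hI (y := t^-1%:C *: (P t ** h))) => //.
  - exact: projP.
  - by apply: (idealZ hI); apply: (idealMl hI).
  have {1}-> : P t = t^-1%:C *: (P t ** a).
    by rewrite Pta scalerA -rmorphM /= mulVf// scale1r.
  rewrite -scalerBr -cmulBr rnormZ.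
  have -> : complex.Re `|t^-1%:C : R[i]| = `|t|^-1.
    by rewrite normc_def /= expr0n /= addr0 sqrtr_sqr normfV.
  rewrite ltr_pdivrMl// mulr1; apply: le_lt_trans (rnormM _ _) _.
  apply: (@le_lt_trans _ _ d) => //.
  rewrite -[leRHS]mul1r ler_pM ?rnorm_ge0//; first exact: rnorm_proj (projP t ts).
  by rewrite rdistC ltW.
pose p := \sum_(t <- s1) P t; pose a1 := \sum_(t <- s1) t%:C *: P t.
pose c := \sum_(t <- s2) t%:C *: P t.
have pE : p = \sum_(t <- s1) (1 : R[i]) *: P t.
  by under eq_bigr do rewrite scale1r.
have pP : projection p.
  rewrite pE; split.
    rewrite (orth_comb_mul us1 projP1 orthP1).
    by under eq_bigr do rewrite mulr1.
  rewrite (orth_comb_star projP1).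
  by under eq_bigr do rewrite conjC1.
have aac : a = a1 + c.
  rewrite /a1 /c !big_filter aE (bigID (fun t => d < `|t|)) /=; congr (_ + _).
  by apply: eq_bigl => t; rewrite leNgt.
have a1p : a1 ** p = a1.
  rewrite /a1 pE (orth_comb_mul us1 projP1 orthP1).
  by under eq_bigr do rewrite mulr1.
have PtPu t u : t \in s1 -> u \in s2 -> P t ** P u = 0 /\ P u ** P t = 0.
  rewrite !mem_filter => /andP[t1 ts] /andP[u1 us'].
  have tu : t != u by apply: contraTneq t1 => ->; rewrite -leNgt.
  by rewrite !orthP// eq_sym.
have cp : c ** p = 0.
  rewrite cmul_suml big1_seq// => u /= us'; rewrite cmul_sumr big1_seq// => t /= ts.
  by rewrite cmulZl (PtPu _ _ ts us').2 scaler0.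
have pc : p ** c = 0.
  rewrite cmul_suml big1_seq// => u /= us'; rewrite cmul_sumr big1_seq// => t /= ts.
  by rewrite cmulZr (PtPu _ _ us' ts).1 scaler0.
have cd : rnorm c <= d.
  apply: orth_comb_bound => //; last by move=> t; rewrite mem_filter => /andP[].
  - by move=> t /s2s; exact: projP.
  - by move=> t u /s2s ts /s2s us'; exact: orthP.
exists p; split => //.
  by rewrite /p big_seq; apply: (ideal_sum hI) => t; exact: IP.
have p1 := rnorm_proj pP.
have rp y : rnorm (y ** p) <= rnorm y.
  by apply: le_trans (rnormM _ _) _; rewrite -[leRHS]mulr1 ler_wpM2l ?rnorm_ge0.
have lp y : rnorm (p ** y) <= rnorm y.
  by apply: le_trans (rnormM _ _) _; rewrite -[leRHS]mul1r ler_wpM2r ?rnorm_ge0.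
rewrite -(@ltr_pXn2r _ 2)// ?nnegrE ?rnorm_ge0 ?ltW// -rnorm_starM.
(* [Q y] is [(1 - p) y (1 - p)]; it kills [a1] and fixes [c]. *)
pose Q y := (y - y ** p) - p ** (y - y ** p).
have -> : cstar (x - x ** p) ** (x - x ** p) = Q a + Q (h - a).
  have QD y z : Q (y + z) = Q y + Q z.
    rewrite /Q cmulDl opprD [y + z + _]addrACA cmulDr opprD. exact: addrACA.
  rewrite -QD [a + _]addrC subrK cstarB cstarM pP.2 cmulBl.
  by rewrite -(cmulA p) (cmulBr (cstar x)) (cmulA (cstar x) x).
have -> : Q a = c.
  by rewrite /Q aac cmulDl a1p cp addr0 [a1 + c]addrC addrK pc subr0.
apply: le_lt_trans (rnormD _ _) _.
have b1 y : rnorm (y - y ** p) <= rnorm y + rnorm y.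
  exact: le_trans (rnormB _ _) (lerD (lexx _) (rp y)).
have b2 : rnorm (Q (h - a)) < d + d + (d + d).
  apply: le_lt_trans (rnormB _ _) _.
  apply: le_lt_trans (lerD (b1 _) (le_trans (lp _) (b1 _))) _.
  by rewrite !ltrD.
apply: lt_le_trans (ler_ltD cd b2) _.
have -> : e ^+ 2 = d * 6 by rewrite /d divfK.
have -> : d + (d + d + (d + d)) = d * 5 by ring.
by rewrite ler_pM2l// ler_nat.
Qed.

End IdealsOfAF.

(** * Gauge invariance *)

Section TorusRoots.
Local Open Scope complex_scope.
Variables (R : realType) (k : nat).
Local Notation C := R[i].

(* For [c = r^2] on the unit circle with [0 <= Re r],
   [1 - Re c = 2 (1 - Re r) (1 + Re r)]. *)
Lemma circle_sqrt (c : C) : `|c| = 1 ->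
  exists r : C, [/\ `|r| = 1, r * r = c &
    2 * (1 - complex.Re r) <= 1 - complex.Re c].
Proof.
move=> c1.
have main (r : C) : r * r = c -> 0 <= complex.Re r ->
    exists r : C, [/\ `|r| = 1, r * r = c &
    2 * (1 - complex.Re r) <= 1 - complex.Re c].
  move=> rc r0; have r1 : `|r| = 1.
    have := congr1 (@Num.norm _ C) rc; rewrite c1 normrM -expr2 => /eqP.
    by rewrite sqrp_eq1// => /eqP.
  exists r; split => //; rewrite -rc.
  have := add_Re2_Im2 r; rewrite r1 expr1n => /(congr1 (@complex.Re R)) /=.
  case: r r0 {rc r1} => x y /= x0 xy.
  have : x <= 1 by have := sqr_ge0 y; nra.
  nra.
have := sqr_sqrtc c; rewrite expr2 => h.
have [r0|r0] := lerP 0 (complex.Re (sqrtc c)); first exact: main h r0.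
apply: (main (- sqrtc c)); first by rewrite mulrNN.
by case: (sqrtc c) r0 {h} => x y /= x0; rewrite oppr_ge0 ltW.
Qed.

Definition torus_pow (w : cvec R k) (n : nat) : cvec R k := \row_i (w 0 i ^+ n).

Lemma torus_powP w n : torus w -> torus (torus_pow w n).
Proof. by move=> tw i; rewrite mxE normrX tw expr1n. Qed.

(** Each of [m] successive coordinatewise square roots, chosen with non-negative real part, at least
    halves [1 - Re], which is at most 2 at the start. *)
Lemma torus_root (m : nat) (z : cvec R k) : torus z ->
  exists w, [/\ torus w, torus_pow w (2 ^ m) = z &
    forall i, 2 ^+ m * (1 - complex.Re (w 0 i)) <= 2].
Proof.
move=> tz.
suff [w [tw wz wi]] : exists w, [/\ torus w, torus_pow w (2 ^ m) = z &
    forall i, 2 ^+ m * (1 - complex.Re (w 0 i)) <= 1 - complex.Re (z 0 i)].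
  exists w; split => // i; apply: le_trans (wi i) _.
  have := add_Re2_Im2 (z 0 i); rewrite tz expr1n => /(congr1 (@complex.Re R)) /=.
  by have := sqr_ge0 (complex.Im (z 0 i)); nra.
elim: m z tz => [|m ih] z tz.
  by exists z; split => // [|i]; [apply/rowP => i; rewrite mxE|rewrite mul1r].
have [r hr] := choice (fun i => circle_sqrt (tz i)).
have [|v [tv vr vi]] := ih (\row_i r i).
  by move=> i; rewrite mxE; have [] := hr i.
exists v; split => //.
  apply/rowP => i; have [_ <- _] := hr i.
  have := congr1 (fun u : cvec R k => u 0 i) vr; rewrite !mxE => <-.
  by rewrite -exprD addnn -mul2n -expnS.
move=> i; have [_ _] := hr i; apply: le_trans.
by rewrite exprS -mulrA ler_wpM2l//; have := vi i; rewrite mxE.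
Qed.

(** This is the form in which the connectedness of the torus is used. *)
Lemma torus_root_near1 (z : cvec R k) (e : R) : torus z -> 0 < e ->
  exists w n, [/\ torus w, torus_pow w n = z & forall i, `|1 - w 0 i| < e%:C].
Proof.
move=> tz e0.
(* On the unit circle the square of [|1 - w|] is [2 (1 - Re w)], hence at most [4 / 2 ^+ m] for a
   root given by [torus_root]. *)
have [m hm] : exists m : nat, 4 < e ^+ 2 * 2 ^+ m.
  have /archi_boundP := divr_ge0 (ler0n R 4) (sqr_ge0 e).
  set m := Num.bound _ => hm; exists m.
  rewrite -ltr_pdivrMl ?exprn_gt0// mulrC; apply: lt_trans hm _.
  by rewrite -natrX ltr_nat ltn_expl.
have [w [tw wz wi]] := torus_root m tz; exists w, (2 ^ m)%N; split => // i.
have := add_Re2_Im2 (w 0 i); rewrite tw expr1n => /(congr1 (@complex.Re R)) /=.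
move=> xy; rewrite normc_def ltcR -[e]ger0_norm ?ltW// -sqrtr_sqr ltr_sqrt ?exprn_gt0//.
have := wi i; case: (w 0 i) xy => x y /= xy h.
rewrite sub0r sqrrN.
have -> : (1 - x) ^+ 2 + y ^+ 2 = 2 * (1 - x).
  by clear -xy; lra.
have M0 : 0 < 2 ^+ m :> R by rewrite exprn_gt0.
rewrite -(ltr_pM2l M0) [ltRHS]mulrC; apply: le_lt_trans hm.
by rewrite mulrCA (_ : 4%:R = 2%:R * 2%:R :> R) ?ler_wpM2l// -natrM.
Qed.

End TorusRoots.

Section GaugeInvariance.
Local Open Scope complex_scope.
Variables (R : realType) (k : nat) (L : kgraph k).
Variables (A : cstarAlgType R) (S : kpath L -> A) (gam : cvec R k -> A -> A).
Hypothesis hgam : gauge_action S gam.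
Variable I : set A.
Hypothesis hI : closed_ideal I.

Lemma gauge_continuous1 (p : A) (e : R) : 0 < e ->
  exists2 d : R, 0 < d & forall w : cvec R k, torus w ->
    (forall i, `|1 - w 0 i| < d%:C) -> rnorm (gam w p - p) < e.
Proof.
move=> e0; have e0' : 0 < e%:C :> R[i] by rewrite ltcR.
have t1 : torus (const_mx 1 : cvec R k) by move=> i; rewrite mxE normr1.
have /subspace_continuousP /(_ _ t1) /cvgrPdist_lt /(_ _ e0') :=
  @gauge_continuous _ _ _ _ _ _ hgam p.
rewrite near_withinE => /nbhs_ballP[d /= d0 dB].
have d0' : 0 < complex.Re d by move: d0; rewrite ltcE /= => /andP[].
exists (complex.Re d) => // w tw hw.
have h : ball (const_mx 1 : cvec R k) d w -> torus w ->
    `|gam (const_mx 1) p - gam w p| < e%:C := dB w.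
move: h; rewrite (gauge1 hgam) rnormE ltcR rdistC; apply => //.
split => // i j; rewrite mxE -ball_normE /ball_ /= ord1.
suff -> : d = (complex.Re d)%:C by [].
by rewrite RRe_real// gtr0_real.
Qed.

(** Write [z] as a power of a [w] that moves [p] by less than 1. As [gam] at each power of [w] is
    contractive, consecutive projections along the powers of [w] are at distance less than 1, so
    membership in [I] passes from one to the next, however many steps there are. *)
Lemma gauge_projection (p : A) (z : cvec R k) :
  projection p -> I p -> torus z -> I (gam z p).
Proof.
move=> pP Ip tz; have [d d0 hd] := gauge_continuous1 p (@ltr01 R).
have [w [n [tw <- wd]]] := torus_root_near1 tz d0.
elim: n => [|n ih].
  have -> : torus_pow w 0 = const_mx 1 by apply/rowP => i; rewrite !mxE.
  by rewrite (gauge1 hgam).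
have tn : torus (torus_pow w n) := torus_powP n tw.
have hn := gauge_hom hgam tn.
have -> : torus_pow w n.+1 = torus_mul (torus_pow w n) w.
  by apply/rowP => i; rewrite !mxE exprSr.
rewrite (gaugeM hgam _ tn tw); apply: (projection_near_ideal hI _ ih).
  have hw := gauge_hom hgam tw.
  by rewrite /projection -(star_homM hn) -(star_homM hw) -(star_homS hn) -(star_homS hw) pP.1 pP.2.
rewrite -(star_homB hn); apply: le_lt_trans (star_hom_contractive hn _) _.
exact: hd.
Qed.

(** [gam z x] is approximated by [gam z (x p) = gam z x ** gam z p], which lies in [I] because
    [gam z p] does. *)
Theorem AF_gauge_invariant : is_AF A -> gauge_invariant gam I.
Proof.
move=> hAF z tz _ [x Ix <-]; have hz := gauge_hom hgam tz.
apply: closed_rnorm; first exact: (ideal_closed hI).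
move=> e e0; have [p [pP Ip xp]] := AF_ideal_projection hAF hI Ix e0.
exists (gam z (cmul x p)).
  by rewrite (star_homM hz); apply: (idealMl hI); apply: gauge_projection.
rewrite -(star_homB hz).
exact: le_lt_trans (star_hom_contractive hz _) xp.
Qed.

End GaugeInvariance.

(** * The Hilbert space of square-summable sequences *)

Section SquareModulus.
Local Open Scope complex_scope.
Variable R : realType.
Implicit Types z w : R[i].

Definition sqmod z : R := complex.Re z ^+ 2 + complex.Im z ^+ 2.

Lemma sqmod_ge0 z : 0 <= sqmod z.
Proof. by rewrite addr_ge0 ?sqr_ge0. Qed.

Lemma sqmodM z w : sqmod (z * w) = sqmod z * sqmod w.
Proof. by case: z w => [a b] [c d]; rewrite /sqmod /=; ring. Qed.

Lemma sqmod_para z w : sqmod (z + w) + sqmod (z - w) = 2 * sqmod z + 2 * sqmod w.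
Proof. by case: z w => [a b] [c d]; rewrite /sqmod /=; ring. Qed.

Lemma sqmod_norm z : `|z| ^+ 2 = (sqmod z)%:C.
Proof. by rewrite -add_Re2_Im2. Qed.

Lemma sqmod_eq0 z : sqmod z = 0 -> z = 0.
Proof.
move=> h; apply/normr0_eq0/eqP; rewrite -sqrf_eq0 sqmod_norm h.
by rewrite rmorph0.
Qed.

(** The real part of [z] times the conjugate of [w]. *)
Definition reip z w : R := complex.Re z * complex.Re w + complex.Im z * complex.Im w.

Lemma reipE z w : reip z w = (sqmod (z + w) - sqmod (z - w)) / 4.
Proof. by case: z w => [a b] [c d]; rewrite /sqmod /reip /=; field. Qed.

Lemma reipC z w : reip z w = reip w z.
Proof. by rewrite /reip mulrC [X in _ + X]mulrC. Qed.

Lemma reipDl z1 z2 w : reip (z1 + z2) w = reip z1 w + reip z2 w.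
Proof. by case: z1 z2 w => [a b] [a' b'] [c d]; rewrite /reip /=; ring. Qed.

Lemma reipZ c z w : reip (c * z) w = reip z ((c^* )%R * w).
Proof. by case: c z w => [e f] [a b] [c d]; rewrite /reip /=; ring. Qed.

Lemma reip_diag z : reip z z = sqmod z.
Proof. by rewrite /reip /sqmod !expr2. Qed.

End SquareModulus.

Lemma real_cvg_unique (R : realType) (u : nat -> R) (a b : R) :
  u @ \oo --> a -> u @ \oo --> b -> a = b.
Proof.
by move=> ua ub; exact: (@norm_cvg_unique R R^o (u @ \oo) _ a b ua ub).
Qed.

Section L2.
Local Open Scope complex_scope.
Variable R : realType.

Definition l2_part (u : nat -> R[i]) n : R := \sum_(i < n) sqmod (u i).

Definition l2_pred : {pred (nat -> R[i])} :=
  [pred u | `[< exists M, forall n, l2_part u n <= M >]].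

Lemma l2_partD u v n : l2_part (u + v) n <= 2 * l2_part u n + 2 * l2_part v n.
Proof.
rewrite /l2_part !mulr_sumr -big_split; apply: ler_sum => i _ /=.
by rewrite -sqmod_para lerDl sqmod_ge0.
Qed.

Lemma l2_partZ c u n : l2_part (c *: u) n = sqmod c * l2_part u n.
Proof. by rewrite /l2_part mulr_sumr; apply: eq_bigr => i _; rewrite -sqmodM. Qed.

Fact l2_submod_closed : submod_closed l2_pred.
Proof.
split=> [|c u v].
  apply/asboolP; exists 0 => n; rewrite /l2_part big1// => i _.
  by rewrite /sqmod /= expr0n addr0.
move=> /asboolP[M hM] /asboolP[K hK]; apply/asboolP.
exists (2 * (sqmod c * M) + 2 * K) => n; apply: le_trans (l2_partD _ _ _) _.
by rewrite l2_partZ lerD// ler_wpM2l// ler_wpM2l ?sqmod_ge0.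
Qed.

HB.instance Definition _ := GRing.isSubmodClosed.Build R[i] (nat -> R[i]) l2_pred
  l2_submod_closed.

Record l2 := L2 { l2_val :> nat -> R[i]; l2_valP : l2_val \in l2_pred }.

HB.instance Definition _ := [isSub for l2_val].
HB.instance Definition _ := [Choice of l2 by <:].
HB.instance Definition _ := [SubChoice_isSubLmodule of l2 by <:].

Implicit Types (u v w : l2) (c : R[i]).

Lemma l2P u v : (forall i, u i = v i) -> u = v.
Proof. by move=> h; apply: val_inj; apply: funext. Qed.

Lemma l2DE u v i : (u + v) i = u i + v i. Proof. by []. Qed.
Lemma l2NE u i : (- u) i = - u i. Proof. by []. Qed.
Lemma l2ZE c u i : (c *: u) i = c * u i. Proof. by []. Qed.
Definition l2sq u : R := limn (l2_part u).

Lemma l2_part_nd u : nondecreasing_seq (l2_part u).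
Proof.
apply/nondecreasing_seqP => n; rewrite /l2_part big_ord_recr /= lerDl.
exact: sqmod_ge0.
Qed.

Lemma l2_part_cvg u : l2_part u @ \oo --> l2sq u.
Proof.
have /asboolP[M hM] := l2_valP u.
apply: nondecreasing_is_cvgn; first exact: l2_part_nd.
by exists M => _ [n _ <-].
Qed.

Lemma l2_part_le u n : l2_part u n <= l2sq u.
Proof. by apply: nondecreasing_cvgn_le; [exact: l2_part_nd|exact: l2_part_cvg]. Qed.

Lemma l2sq_lub u M : (forall n, l2_part u n <= M) -> l2sq u <= M.
Proof. by move=> h; apply: limr_le; [exact: l2_part_cvg|exact: nearW]. Qed.

Lemma l2sq_ge0 u : 0 <= l2sq u.
Proof. by have := l2_part_le u 0; rewrite /l2_part big_ord0. Qed.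

Lemma l2_coord_le u i : sqmod (u i) <= l2sq u.
Proof.
apply: le_trans (l2_part_le u i.+1); rewrite /l2_part big_ord_recr /= lerDr.
by apply: sumr_ge0 => j _; exact: sqmod_ge0.
Qed.

Lemma l2sq_eq0 u : l2sq u = 0 -> u = 0.
Proof.
move=> h; apply: l2P => i; apply: sqmod_eq0; apply/eqP.
by rewrite eq_le sqmod_ge0 -h l2_coord_le.
Qed.

(* The real part of the inner product; for the adjoint of a complex linear map
   it carries the same information as the inner product. *)
Definition rip u v : R := (l2sq (u + v) - l2sq (u - v)) / 4.

(** Identifies the polarisation formula with the series over the coordinates. The algebraic rules
    for [rip] then follow from termwise identities and the uniqueness of limits. *)
Lemma rip_cvg u v : (\sum_(i < n) reip (u i) (v i)) @[n --> \oo] --> rip u v.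
Proof.
have -> : (fun n => \sum_(i < n) reip (u i) (v i)) =
    (fun n => (l2_part (u + v) n - l2_part (u - v) n) / 4).
  apply: funext => n; rewrite /l2_part -sumrB mulr_suml.
  by apply: eq_bigr => i _; rewrite reipE.
by apply: cvgMl; apply: cvgB; exact: l2_part_cvg.
Qed.

Lemma rip_uniq u v l : (\sum_(i < n) reip (u i) (v i)) @[n --> \oo] --> l -> rip u v = l.
Proof.
by move=> h; exact: real_cvg_unique (@rip_cvg u v) h.
Qed.

Lemma ripC u v : rip u v = rip v u.
Proof.
by apply: rip_uniq; under eq_fun do under eq_bigr do rewrite reipC; exact: rip_cvg.
Qed.

Lemma ripDl u1 u2 v : rip (u1 + u2) v = rip u1 v + rip u2 v.
Proof.
apply: rip_uniq; under eq_fun do under eq_bigr do rewrite reipDl.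
by under eq_fun do rewrite big_split; apply: cvgD; exact: rip_cvg.
Qed.

Lemma ripZl c u v : rip (c *: u) v = rip u ((c^* )%R *: v).
Proof.
by apply: rip_uniq; under eq_fun do under eq_bigr do rewrite reipZ; exact: rip_cvg.
Qed.

Lemma rip_diag u : rip u u = l2sq u.
Proof.
by apply: rip_uniq; under eq_fun do under eq_bigr do rewrite reip_diag; exact: l2_part_cvg.
Qed.

Lemma ripRl (t : R) u v : rip (t%:C *: u) v = t * rip u v.
Proof.
apply: rip_uniq.
have -> : (fun n => \sum_(i < n) reip ((t%:C *: u) i) (v i)) =
    (fun n => t * \sum_(i < n) reip (u i) (v i)).
  apply: funext => n; rewrite mulr_sumr; apply: eq_bigr => i _.
  by rewrite l2ZE; case: (u i) (v i) => [a b] [c d]; rewrite /reip /=; ring.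
by apply: cvgMr; exact: rip_cvg.
Qed.

Lemma ripDr u v1 v2 : rip u (v1 + v2) = rip u v1 + rip u v2.
Proof. by rewrite ripC ripDl (ripC v1) (ripC v2). Qed.

Lemma ripNl u v : rip (- u) v = - rip u v.
Proof.
have -> : - u = (-1)%:C *: u by rewrite rmorphN rmorph1 scaleN1r.
by rewrite ripRl mulN1r.
Qed.

Lemma ripNr u v : rip u (- v) = - rip u v.
Proof. by rewrite ripC ripNl ripC. Qed.

Lemma ripBl u v w : rip (u - v) w = rip u w - rip v w.
Proof. by rewrite ripDl ripNl. Qed.

Lemma ripBr u v w : rip w (u - v) = rip w u - rip w v.
Proof. by rewrite ripDr ripNr. Qed.

Lemma rip_nondeg u v : (forall w, rip u w = rip v w) -> u = v.
Proof.
move=> h; apply/eqP; rewrite -subr_eq0; apply/eqP; apply: l2sq_eq0.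
by rewrite -rip_diag ripBl h subrr.
Qed.

Definition l2norm u : R := Num.sqrt (l2sq u).

Lemma l2norm_ge0 u : 0 <= l2norm u. Proof. exact: sqrtr_ge0. Qed.

Lemma l2normE u : l2norm u ^+ 2 = rip u u.
Proof. by rewrite rip_diag sqr_sqrtr ?l2sq_ge0. Qed.

Lemma l2norm_eq0 u : l2norm u = 0 -> u = 0.
Proof. by move=> h; apply: l2sq_eq0; rewrite -rip_diag -l2normE h expr0n. Qed.

Lemma l2norm0 : l2norm 0 = 0.
Proof.
apply/eqP; rewrite -sqrf_eq0 l2normE; apply/eqP.
by apply: (addrI (rip 0 0)); rewrite -ripDl !addr0.
Qed.

Lemma l2sqZ c u : l2sq (c *: u) = sqmod c * l2sq u.
Proof.
apply: (real_cvg_unique (@l2_part_cvg _)).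
rewrite (_ : l2_part _ = fun n => sqmod c * l2_part u n); last first.
  by apply: funext => n; rewrite -l2_partZ.
by apply: cvgMr; exact: l2_part_cvg.
Qed.

Lemma l2normZ c u : l2norm (c *: u) = complex.Re `|c| * l2norm u.
Proof. by rewrite /l2norm l2sqZ sqrtrM ?sqmod_ge0// normc_def. Qed.

Lemma rip_cauchy u v : `|rip u v| <= l2norm u * l2norm v.
Proof.
have H x y : rip x y <= l2norm x * l2norm y.
  have [y0|] := eqVneq (l2norm y) 0.
    have -> : rip x y = 0 by rewrite (l2norm_eq0 y0) -(subrr 0) ripBr subrr.
    by rewrite mulr_ge0 ?l2norm_ge0.
  have [x0|] := eqVneq (l2norm x) 0.
    have -> : rip x y = 0 by rewrite (l2norm_eq0 x0) -(subrr 0) ripBl subrr.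
    by rewrite mulr_ge0 ?l2norm_ge0.
  have := l2norm_ge0 x; have := l2norm_ge0 y.
  set a := l2norm x; set b := l2norm y => b0 a0 a1 b1.
  (* With [a] and [b] the norms of [x] and [y], this square expands to [2 a b (a b - rip x y)]. *)
  have : 0 <= l2sq (b%:C *: x - a%:C *: y) by exact: l2sq_ge0.
  rewrite -rip_diag ripBl !ripBr !ripRl !(ripC _ (_ *: _)) !ripRl (ripC y x).
  rewrite -!l2normE -/a -/b => h.
  have ab : 0 < a * b by rewrite mulr_gt0 // lt_neqAle eq_sym ?a0 ?b0 ?a1 ?b1.
  rewrite -(ler_pM2l ab); move: (rip x y) h {a1 b1 a0 b0} => r.
  by nra.
rewrite ler_norml H andbT lerNl -ripNl.
by apply: le_trans (H _ _) _; rewrite -scaleN1r l2normZ normrN1 mul1r.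
Qed.

Lemma l2normD u v : l2norm (u + v) <= l2norm u + l2norm v.
Proof.
rewrite -(@ler_pXn2r _ 2)// ?nnegrE ?addr_ge0 ?l2norm_ge0//.
rewrite l2normE ripDl !ripDr sqrrD -!l2normE (ripC v u).
have := le_trans (ler_norm _) (rip_cauchy u v).
move: (rip u v) (l2norm u) (l2norm v) => x y z h; nra.
Qed.

End L2.

Section L2Complete.
Local Open Scope complex_scope.
Variable R : realType.
Implicit Types (u v w : l2 R).

Lemma l2normN u : l2norm (- u) = l2norm u.
Proof. by rewrite -scaleN1r l2normZ normrN1 mul1r. Qed.

Lemma l2_distC u v : l2norm (u - v) = l2norm (v - u).
Proof. by rewrite -l2normN opprB. Qed.

(** The coordinates converge, and a bound on finitely many coordinates of [x m - x n] survives the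
    limit in [n]. Thus [x m - l] is square-summable with small norm, and so [l] is
    square-summable. *)
Lemma l2_complete (x : nat -> l2 R) :
  (forall e : R, 0 < e -> exists N, forall m n, (N <= m)%N -> (N <= n)%N ->
     l2norm (x m - x n) < e) ->
  exists l, forall e : R, 0 < e -> exists N, forall n, (N <= n)%N ->
    l2norm (x n - l) <= e.
Proof.
move=> hx.
have coord (g : R[i] -> R) : (forall z z', g (z - z') = g z - g z') ->
    (forall z, g z ^+ 2 <= sqmod z) -> forall i, cvgn (fun n => g (x n i)).
  move=> gB gle i; apply/cauchy_cvgP/cauchyP => e e0.
  have [N hN] := hx _ e0; exists (g (x N i)); exists N => //= n /= Nn.
  rewrite -ball_normE /ball_ /= -gB.
  apply: le_lt_trans (hN N n (leqnn N) Nn).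
  rewrite -(@ler_pXn2r _ 2)// ?nnegrE ?l2norm_ge0// real_normK ?num_real//.
  rewrite l2normE rip_diag; apply: le_trans (gle _) _.
  exact: (l2_coord_le (x N - x n) i).
have reB z z' : complex.Re (z - z') = complex.Re z - complex.Re z' :> R.
  by case: z z' => [a b] [c d].
have imB z z' : complex.Im (z - z') = complex.Im z - complex.Im z' :> R.
  by case: z z' => [a b] [c d].
have cre := coord (@complex.Re R) reB (fun z => ltac:(by rewrite /sqmod lerDl sqr_ge0)).
have cim := coord (@complex.Im R) imB (fun z => ltac:(by rewrite /sqmod lerDr sqr_ge0)).
pose l i : R[i] := Complex (limn (fun n => complex.Re (x n i)))
  (limn (fun n => complex.Im (x n i))).
have coord_lim m i : sqmod (x m i - x n i) @[n --> \oo] --> sqmod (x m i - l i).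
  rewrite /sqmod reB imB; under eq_fun do rewrite reB imB.
  by apply: cvgD; rewrite expr2; under eq_fun do rewrite expr2; apply: cvgM;
    apply: cvgB; try exact: cvg_cst; [exact: cre|exact: cre|exact: cim|exact: cim].
have part_lim m N : \sum_(i < N) sqmod (x m i - x n i) @[n --> \oo] -->
    \sum_(i < N) sqmod (x m i - l i).
  elim: N => [|N ih].
    by under eq_fun do rewrite big_ord0; rewrite big_ord0; exact: cvg_cst.
  under eq_fun do rewrite big_ord_recr; rewrite big_ord_recr.
  by apply: cvgD ih (coord_lim _ _).
have bound (e : R) : 0 < e -> exists M, forall m, (M <= m)%N -> forall N,
    \sum_(i < N) sqmod (x m i - l i) <= e ^+ 2.
  move=> e0; have [M hM] := hx _ e0; exists M => m Mm N.
  apply: (cvgr_to_le (part_lim m N)).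
  exists M => //= n /= Mn.
  apply: le_trans (l2_part_le (x m - x n) N) _.
  rewrite -rip_diag -l2normE ler_pXn2r// ?nnegrE ?l2norm_ge0 ?(ltW e0)//.
  by rewrite ltW// hM.
have lP : l \in @l2_pred R.
  have [M hM] := bound _ (@ltr01 R).
  have hd : (x M : nat -> R[i]) - l \in @l2_pred R.
    by apply/asboolP; exists (1 ^+ 2) => N; exact: hM.
  have -> : l = (x M : nat -> R[i]) - ((x M : nat -> R[i]) - l).
    by rewrite opprB addrC subrK.
  by apply: rpredB => //; exact: l2_valP.
exists (L2 lP) => e e0; have [M hM] := bound _ e0; exists M => n Mn.
rewrite -(@ler_pXn2r _ 2)// ?nnegrE ?l2norm_ge0 ?(ltW e0)//.
by rewrite l2normE rip_diag; apply: l2sq_lub => N; exact: hM.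
Qed.

End L2Complete.

(** * The C*-algebra of bounded operators *)

(** A Cauchy filter contains a ball of radius [1 / (n + 1)] for each [n]. The centres form a Cauchy
    sequence, because two members of the filter meet, and the filter converges to its limit. *)
Lemma seq_complete (R : realType) (V : normedModType R[i]) :
  (forall u : nat -> V,
    (forall e : R, 0 < e -> exists N, forall m n, (N <= m)%N -> (N <= n)%N ->
      rnorm (u m - u n) < e) ->
    exists l, forall e : R, 0 < e -> exists N, forall n, (N <= n)%N ->
      rnorm (u n - l) <= e) ->
  forall F : set_system V, ProperFilter F -> cauchy F -> cvg F.
Proof.
move=> hV F FF /cauchyP cF.
have cF' (n : nat) : exists x : V, F (ball x (n.+1%:R^-1 : R[i])).
  by apply: cF; rewrite invr_gt0.
have [x hx] := choice cF'.
pose r n : R := n.+1%:R^-1.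
have rE n : (n.+1%:R^-1 : R[i]) = real_complex R (r n) by rewrite fmorphV rmorph_nat.
have bE y (n : nat) z : ball y (n.+1%:R^-1 : R[i]) z <-> rnorm (y - z) < r n.
  by rewrite -ball_normE /ball_ /= rnormE rE ltcR.
have inter m n : rnorm (x m - x n) < r m + r n.
  have [z [/bE h1 /bE h2]] := filter_ex (filterI (hx m) (hx n)).
  rewrite -[x m](subrK z) -addrA; apply: le_lt_trans (rnormD _ _) _.
  by rewrite ltrD// rdistC.
have r_small (e : R) : 0 < e -> exists N, forall n, (N <= n)%N -> r n < e.
  move=> e0; have /archi_boundP : 0 <= e^-1 by rewrite invr_ge0 ltW.
  set N := Num.bound _ => hN; exists N => n Nn.
  rewrite /r invf_plt ?posrE//; apply: lt_le_trans hN _.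
  by rewrite ler_nat (leq_trans Nn).
have [|l hl] := hV x.
  move=> e e0; have [N hN] := r_small _ (divr_gt0 e0 (ltr0Sn _ 1)).
  exists N => m n Nm Nn; apply: lt_trans (inter _ _) _.
  by rewrite (splitr e) ltrD ?hN.
apply/cvg_ex; exists l; apply/cvg_ballP => e e0.
have e0' : 0 < complex.Re e by move: e0; rewrite ltcE /= => /andP[].
have [N hN] := r_small _ (divr_gt0 e0' (ltr0Sn _ 1)).
have [M hM] := hl _ (divr_gt0 e0' (ltr0Sn _ 1)).
apply: filterS (hx (maxn N M)) => z /bE h.
rewrite -ball_normE /ball_ /= rnormE.
have -> : e = real_complex R (complex.Re e) by rewrite RRe_real// gtr0_real.
rewrite ltcR -[l](subrK (x (maxn N M))) -addrA; apply: le_lt_trans (rnormD _ _) _.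
rewrite (splitr (complex.Re e)) ler_ltD//; first by rewrite rdistC hM// leq_maxr.
by apply: lt_trans h _; rewrite hN// leq_maxl.
Qed.

Section BoundedOperators.
Local Open Scope complex_scope.
Variable R : realType.
Local Notation H := (l2 R).
Implicit Types (u v w : H).

Lemma rip0l v : rip 0 v = 0.
Proof. by rewrite -(subrr 0) ripBl subrr. Qed.

Lemma rip0r v : rip v 0 = 0.
Proof. by rewrite ripC rip0l. Qed.

Definition adjoints (a b : H -> H) : Prop := forall u v, rip (a u) v = rip u (b v).

Definition bounded_by (M : R) (a : H -> H) : Prop :=
  forall u, l2norm (a u) <= M * l2norm u.

Lemma adjoints_sym a b : adjoints a b -> adjoints b a.
Proof. by move=> ab u v; rewrite ripC -ab ripC. Qed.

Definition homogeneous (a : H -> H) : Prop := forall (c : R[i]) u, a (c *: u) = c *: a u.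

Lemma adjoints_add a b u v : adjoints a b -> a (u + v) = a u + a v.
Proof.
by move=> ab; apply: rip_nondeg => w; rewrite ab !ripDl !ab.
Qed.

Lemma ripZr (c : R[i]) u v : rip u (c *: v) = rip ((c^* )%R *: u) v.
Proof. by rewrite ripZl conjCK. Qed.

Lemma adjoints_homogeneous a b : adjoints a b -> homogeneous a -> homogeneous b.
Proof.
move=> ab ha c v; apply: rip_nondeg => u.
by rewrite ripC -ab ripZr -ha ab -ripZr ripC.
Qed.

Lemma adjoints_bounded a b M : 0 <= M -> adjoints a b -> bounded_by M a -> bounded_by M b.
Proof.
move=> M0 ab aM v; have := l2norm_ge0 (b v).
rewrite le_eqVlt => /predU1P[<-|b0]; first by rewrite mulr_ge0 ?l2norm_ge0.
rewrite -(ler_pM2r b0) -expr2 l2normE -ab.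
apply: le_trans (le_trans (ler_norm _) (rip_cauchy _ _)) _.
by rewrite mulrAC ler_wpM2r ?l2norm_ge0.
Qed.

(* [rip] only sees real parts, so an adjoint makes [a] real-linear; complex
   homogeneity has to be required separately. *)
Definition bop_pred : {pred (H -> H)} :=
  [pred a | `[< exists b M,
     [/\ 0 <= M, adjoints a b, bounded_by M a & homogeneous a] >]].

Fact bop_submod_closed : submod_closed bop_pred.
Proof.
split=> [|c a b].
  apply/asboolP; exists (fun=> 0), 0; split => // [u v|u|c u].
  - by rewrite rip0l rip0r.
  - by rewrite mul0r l2norm0.
  - by rewrite scaler0.
move=> /asboolP[a' [M [M0 aa' aM ha]]] /asboolP[b' [N [N0 bb' bN hb]]]; apply/asboolP.
have c0 : 0 <= complex.Re `|c| by rewrite -ler0c RRe_real.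
have cE u : (c *: a + b) u = c *: a u + b u by [].
exists (fun v => (c^* )%R *: a' v + b' v), (complex.Re `|c| * M + N); split.
- by rewrite addr_ge0 ?mulr_ge0.
- by move=> u v; rewrite cE ripDl -ha aa' bb' ripDr ripZr conjCK.
- move=> u; rewrite cE; apply: le_trans (l2normD _ _) _.
  rewrite mulrDl l2normZ -mulrA; apply: lerD (bN u); apply: ler_wpM2l => //.
- by move=> d u; rewrite !cE ha hb scalerDr !scalerA mulrC.
Qed.

HB.instance Definition _ := GRing.isSubmodClosed.Build R[i] (H -> H) bop_pred
  bop_submod_closed.

Record bop := Bop { bop_val :> H -> H; bop_valP : bop_val \in bop_pred }.

HB.instance Definition _ := [isSub for bop_val].
HB.instance Definition _ := [Choice of bop by <:].
HB.instance Definition _ := [SubChoice_isSubLmodule of bop by <:].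

Implicit Types (a b c : bop) (z : R[i]).

Lemma bopP a b : (forall u, a u = b u) -> a = b.
Proof. by move=> h; apply: val_inj; apply: funext. Qed.

Lemma bopDE a b u : (a + b) u = a u + b u. Proof. by []. Qed.
Lemma bopZE z a u : (z *: a) u = z *: a u. Proof. by []. Qed.

Lemma bopZr a z u : a (z *: u) = z *: a u.
Proof. by have /asboolP[b [M [_ _ _ ->]]] := bop_valP a. Qed.

Lemma bopDr a u v : a (u + v) = a u + a v.
Proof. by have /asboolP[b [M [_ ab _ _]]] := bop_valP a; apply: adjoints_add ab. Qed.

Lemma bop_at0 a : a 0 = 0.
Proof. by rewrite -[X in a X](scale0r (0 : H)) bopZr scale0r. Qed.

Definition opnorm a : R := sup [set l2norm (a u) | u in [set u | l2norm u <= 1]].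

Let opnorm_has_sup a : has_sup [set l2norm (a u) | u in [set u | l2norm u <= 1]].
Proof.
have /asboolP[b [M [M0 _ aM _]]] := bop_valP a; split.
  by exists (l2norm (a 0)), 0 => //=; rewrite l2norm0.
exists M => _ [u /= u1 <-]; apply: le_trans (aM u) _.
by rewrite -[leRHS]mulr1 ler_wpM2l.
Qed.

Lemma opnorm_ge0 a : 0 <= opnorm a.
Proof.
apply: (@le_trans _ _ (l2norm (a 0))); first exact: l2norm_ge0.
by apply: sup_ubound; [exact: (opnorm_has_sup a).2|exists 0; rewrite //= l2norm0].
Qed.

Lemma opnormP a : bounded_by (opnorm a) a.
Proof.
move=> u; have := l2norm_ge0 u; rewrite le_eqVlt => /predU1P[/esym u0|u0].
  by rewrite (l2norm_eq0 u0) bop_at0 l2norm0 mulr0.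
rewrite mulrC -ler_pdivrMl//.
have scale v : l2norm ((l2norm u)^-1%:C *: v) = (l2norm u)^-1 * l2norm v.
  by rewrite l2normZ ger0_norm// ler0c invr_ge0 ltW.
rewrite -scale -bopZr; apply: sup_ubound; first exact: (opnorm_has_sup a).2.
by exists ((l2norm u)^-1%:C *: u) => //=; rewrite scale mulVf// gt_eqF.
Qed.

Lemma opnorm_le a M : 0 <= M -> bounded_by M a -> opnorm a <= M.
Proof.
move=> M0 aM; apply: sup_le_ub; first exact: (opnorm_has_sup a).1.
move=> _ [u /= u1 <-]; apply: le_trans (aM u) _.
by rewrite -[leRHS]mulr1 ler_wpM2l.
Qed.

Fact comp_subproof a b : (a : H -> H) \o b \in bop_pred.
Proof.
have /asboolP[a' [M [M0 aa' aM ha]]] := bop_valP a.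
have /asboolP[b' [N [N0 bb' bN hb]]] := bop_valP b.
apply/asboolP; exists (b' \o a'), (M * N); split.
- exact: mulr_ge0.
- by move=> u v /=; rewrite aa' bb'.
- move=> u /=; apply: le_trans (aM _) _; rewrite -mulrA; apply: ler_wpM2l => //.
- by move=> c u /=; rewrite hb ha.
Qed.

Definition bop_comp a b := Bop (comp_subproof a b).

Lemma bop_compE a b u : bop_comp a b u = a (b u). Proof. by []. Qed.

Fact bop_compA a b c : bop_comp a (bop_comp b c) = bop_comp (bop_comp a b) c.
Proof. exact: bopP. Qed.
Fact bop_compDl a b c : bop_comp (a + b) c = bop_comp a c + bop_comp b c.
Proof. exact: bopP. Qed.
Fact bop_compDr a b c : bop_comp a (b + c) = bop_comp a b + bop_comp a c.
Proof. by apply: bopP => u; rewrite bopDE !bop_compE bopDE bopDr. Qed.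
Fact bop_compZl z a b : bop_comp (z *: a) b = z *: bop_comp a b.
Proof. exact: bopP. Qed.
Fact bop_compZr z a b : bop_comp a (z *: b) = z *: bop_comp a b.
Proof. by apply: bopP => u; rewrite bopZE !bop_compE bopZE bopZr. Qed.

(** The adjoint is part of the definition of [bop_pred], so no representation theorem for
    functionals is involved; what remains is that it is bounded and homogeneous itself. *)
Fact star_subproof a : exists b : bop, adjoints a b.
Proof.
have /asboolP[b [M [M0 ab aM ha]]] := bop_valP a.
have bP : b \in bop_pred.
  apply/asboolP; exists a, M; split => //; first exact: adjoints_sym.
    exact: adjoints_bounded aM.
  exact: adjoints_homogeneous ha.
by exists (Bop bP).
Qed.

Definition bop_star a : bop := projT1 (cid (star_subproof a)).

Lemma bop_starP a : adjoints a (bop_star a).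
Proof. by rewrite /bop_star; case: cid. Qed.

Lemma bop_star_uniq a b : adjoints a b -> bop_star a = b.
Proof.
move=> ab; apply: bopP => u; apply: rip_nondeg => v.
by rewrite ripC -bop_starP ab ripC.
Qed.

Lemma bop_starK a : bop_star (bop_star a) = a.
Proof. by apply: bop_star_uniq; apply: adjoints_sym; exact: bop_starP. Qed.

Lemma bop_starD a b : bop_star (a + b) = bop_star a + bop_star b.
Proof.
apply: bop_star_uniq => u v; rewrite !bopDE ripDl ripDr.
by rewrite (bop_starP a) (bop_starP b).
Qed.

Lemma bop_starZ z a : bop_star (z *: a) = (z^* )%R *: bop_star a.
Proof.
apply: bop_star_uniq => u v; rewrite !bopZE ripZr conjCK -bopZr.
by rewrite (bop_starP a).
Qed.

Lemma bop_starN a : bop_star (- a) = - bop_star a.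
Proof. by rewrite -scaleN1r bop_starZ rmorphN rmorph1 scaleN1r. Qed.

Lemma bop_star_comp a b : bop_star (bop_comp a b) = bop_comp (bop_star b) (bop_star a).
Proof.
by apply: bop_star_uniq => u v /=; rewrite (bop_starP a) (bop_starP b).
Qed.

Lemma opnorm_star_le a : opnorm (bop_star a) <= opnorm a.
Proof.
apply: opnorm_le; first exact: opnorm_ge0.
apply: (adjoints_bounded (a := a)); [exact: opnorm_ge0|exact: bop_starP|exact: opnormP].
Qed.

Lemma opnorm_star a : opnorm (bop_star a) = opnorm a.
Proof. by apply/eqP; rewrite eq_le opnorm_star_le -{1}(bop_starK a) opnorm_star_le. Qed.

Lemma opnormM a b : opnorm (bop_comp a b) <= opnorm a * opnorm b.
Proof.
apply: opnorm_le => [|u]; first by rewrite mulr_ge0 ?opnorm_ge0.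
apply: le_trans (opnormP a (b u)) _; rewrite -mulrA; apply: ler_wpM2l.
  exact: opnorm_ge0.
exact: opnormP.
Qed.

(** The lower bound is the Cauchy-Schwarz inequality applied to [rip (a u) (a u) = rip u (bop_star a
    (a u))]. *)
Lemma opnorm_starM a : opnorm (bop_comp (bop_star a) a) = opnorm a ^+ 2.
Proof.
apply/eqP; rewrite eq_le; apply/andP; split.
  by apply: le_trans (opnormM _ _) _; rewrite opnorm_star expr2.
set s := bop_comp _ _; have s0 := opnorm_ge0 s.
rewrite -(sqr_sqrtr s0) ler_pXn2r ?nnegrE ?opnorm_ge0 ?sqrtr_ge0//.
apply: opnorm_le => [|u]; first exact: sqrtr_ge0.
rewrite -(@ler_pXn2r _ 2)// ?nnegrE ?mulr_ge0 ?l2norm_ge0 ?sqrtr_ge0//.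
rewrite exprMn (sqr_sqrtr s0) l2normE bop_starP.
apply: le_trans (le_trans (ler_norm _) (rip_cauchy _ _)) _.
rewrite mulrC expr2 mulrA; apply: ler_wpM2r; first exact: l2norm_ge0.
exact: opnormP s u.
Qed.

Definition bop_norm a : R[i] := (opnorm a)%:C.

Fact bop_normD a b : bop_norm (a + b) <= bop_norm a + bop_norm b.
Proof.
rewrite /bop_norm -rmorphD lecR; apply: opnorm_le => [|u].
  by rewrite addr_ge0 ?opnorm_ge0.
by apply: le_trans (l2normD _ _) _; rewrite mulrDl; apply: lerD; exact: opnormP.
Qed.

Fact bop_normZ z a : bop_norm (z *: a) = `|z| * bop_norm a.
Proof.
have le y b : opnorm (y *: b) <= complex.Re `|y| * opnorm b.
  have y0 : 0 <= complex.Re `|y| by rewrite -ler0c RRe_real.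
  apply: opnorm_le => [|u]; first by rewrite mulr_ge0 ?opnorm_ge0.
  by rewrite bopZE l2normZ -mulrA; apply: ler_wpM2l => //; exact: opnormP.
have -> : `|z| = (complex.Re `|z|)%:C by rewrite [RHS]RRe_real.
rewrite /bop_norm -[RHS]rmorphM; congr (_%:C); apply/eqP; rewrite eq_le le andTb.
have [->|z0] := eqVneq z 0; first by rewrite normr0 mul0r opnorm_ge0.
have z1 : complex.Re `|z| * complex.Re `|z^-1| = 1.
  have h : `|z| * `|z^-1| = 1 by rewrite -normrM mulfV// normr1.
  have := congr1 (@complex.Re R) h; rewrite normc_def (normc_def z^-1).
  by rewrite -rmorphM.
have zp : 0 < complex.Re `|z|.
  have : 0 < `|z| by rewrite normr_gt0.
  by rewrite ltcE => /andP[].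
rewrite -[X in _ * opnorm X]scale1r -(mulVf z0) -scalerA.
apply: le_trans (ler_wpM2l (ltW zp) (le _ _)) _.
by rewrite mulrA z1 mul1r.
Qed.

Fact bop_norm_eq0 a : bop_norm a = 0 -> a = 0.
Proof.
move=> [a0]; apply: bopP => u; apply: l2norm_eq0; apply/eqP.
rewrite eq_le l2norm_ge0 andbT; apply: le_trans (opnormP a u) _.
by rewrite a0 mul0r.
Qed.

HB.instance Definition _ := Lmodule_isNormed.Build R[i] bop
  bop_normD bop_normZ bop_norm_eq0.

End BoundedOperators.

Section OperatorAlgebra.
Local Open Scope complex_scope.
Variable R : realType.
Local Notation H := (l2 R).
Implicit Types (a b c : bop R) (z : R[i]).

Lemma bop_pointwise_limit (f : nat -> bop R) :
  (forall e : R, 0 < e -> exists N, forall m n, (N <= m)%N -> (N <= n)%N ->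
      opnorm (f m - f n) < e) ->
  exists a : H -> H, homogeneous a /\
    forall e : R, 0 < e -> exists N, forall n, (N <= n)%N ->
      forall u, l2norm (f n u - a u) <= e * l2norm u.
Proof.
move=> hf.
have ptw u : exists l, forall e : R, 0 < e -> exists N, forall n, (N <= n)%N ->
    l2norm (f n u - l) <= e.
  apply: (@l2_complete _ (fun n => f n u)) => e e0.
  have u1 : 0 < l2norm u + 1 by rewrite ltr_wpDl ?l2norm_ge0.
  have [N hN] := hf _ (divr_gt0 e0 u1); exists N => m n Nm Nn.
  have := hN m n Nm Nn; rewrite ltr_pdivlMr//; apply: le_lt_trans.
  apply: le_trans (opnormP (f m - f n) u) _.
  by apply: ler_wpM2l; [exact: opnorm_ge0|rewrite lerDl].
have [a ha] := choice ptw; exists a.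
have unif (e : R) : 0 < e -> exists N, forall n, (N <= n)%N ->
    forall u, l2norm (f n u - a u) <= e * l2norm u.
  move=> e0; have [N hN] := hf _ e0; exists N => n Nn u.
  apply/ler_addgt0Pr => d d0; have [M hM] := ha u _ d0.
  rewrite -[f n u](subrK (f (maxn N M) u)) -addrA.
  apply: le_trans (l2normD _ _) _; apply: lerD; last by rewrite hM// leq_maxr.
  apply: le_trans (opnormP (f n - f (maxn N M)) u) _.
  apply: ler_wpM2r; first exact: l2norm_ge0.
  by rewrite ltW// hN// leq_maxl.
split => // c u; apply/eqP; rewrite -subr_eq0; apply/eqP/l2norm_eq0/eqP.
rewrite eq_le l2norm_ge0 andbT; apply/ler_addgt0Pr => e e0; rewrite add0r.
set K := l2norm (c *: u).
(* Two error terms of size [K] have to be absorbed; the summand 1 covers [K = 0]. *)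
have K1 : 0 < K + K + 1 by rewrite ltr_wpDl// addr_ge0 ?l2norm_ge0.
have [N hN] := unif _ (divr_gt0 e0 K1).
have -> : a (c *: u) - c *: a u =
    (a (c *: u) - f N (c *: u)) + c *: (f N u - a u).
  by rewrite bopZr scalerBr addrA subrK.
apply: le_trans (l2normD _ _) _; rewrite l2_distC l2normZ.
apply: (@le_trans _ _ (e / (K + K + 1) * (K + K))).
  rewrite mulrDr; apply: lerD; first exact: hN.
  rewrite [X in _ <= _ * X]l2normZ mulrCA; apply: ler_wpM2l; last exact: hN.
  by rewrite -ler0c RRe_real.
by rewrite -mulrA ger_pMr// mulrC ler_pdivrMr// mul1r lerDl.
Qed.

(** The limit must be given an adjoint. It is the limit of the adjoints, which form a Cauchy
    sequence as the star is isometric. *)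
Lemma bop_seq_complete (f : nat -> bop R) :
  (forall e : R, 0 < e -> exists N, forall m n, (N <= m)%N -> (N <= n)%N ->
      rnorm (f m - f n) < e) ->
  exists a : bop R, forall e : R, 0 < e -> exists N, forall n, (N <= n)%N ->
      rnorm (f n - a) <= e.
Proof.
move=> hf; have [a [ha fa]] := bop_pointwise_limit hf.
have [|b [_ fb]] := @bop_pointwise_limit (fun n => bop_star (f n)).
  move=> e e0; have [N hN] := hf _ e0; exists N => m n Nm Nn.
  by rewrite -bop_starN -bop_starD opnorm_star; exact: hN.
have ab : adjoints a b.
  move=> u v; apply/eqP; rewrite -subr_eq0 -normr_eq0 eq_le normr_ge0 andbT.
  apply/ler_addgt0Pr => e e0; rewrite add0r.
  set K := l2norm u * l2norm v.
  have K0 : 0 <= K by rewrite mulr_ge0 ?l2norm_ge0.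
  have K1 : 0 < K + K + 1 by rewrite ltr_wpDl// addr_ge0.
  have [N hN] := fa _ (divr_gt0 e0 K1); have [M hM] := fb _ (divr_gt0 e0 K1).
  set n := maxn N M.
  have -> : rip (a u) v - rip u (b v) = rip (a u - f n u) v + rip u (bop_star (f n) v - b v).
    by rewrite ripBl ripBr (bop_starP (f n)) addrA subrK.
  apply: le_trans (ler_normD _ _) _.
  apply: (@le_trans _ _ (e / (K + K + 1) * (K + K))).
    rewrite mulrDr; apply: lerD; apply: le_trans (rip_cauchy _ _) _.
      rewrite l2_distC /K mulrA; apply: ler_wpM2r; first exact: l2norm_ge0.
      by apply: hN; exact: leq_maxl.
    rewrite /K mulrCA; apply: ler_wpM2l; first exact: l2norm_ge0.
    by apply: hM; exact: leq_maxr.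
  by rewrite -mulrA ger_pMr// mulrC ler_pdivrMr// mul1r lerDl.
have aP : a \in @bop_pred R.
  have [N hN] := fa _ (@ltr01 R).
  apply/asboolP; exists b, (opnorm (f N) + 1); split => //.
  - by rewrite addr_ge0 ?opnorm_ge0.
  - move=> u; rewrite -[a u](subrK (f N u)) addrC; apply: le_trans (l2normD _ _) _.
    rewrite mulrDl; apply: lerD; first exact: opnormP.
    by rewrite l2_distC; exact: hN.
exists (Bop aP) => e e0; have [N hN] := fa _ e0; exists N => n Nn.
by apply: opnorm_le; [exact: ltW|exact: hN].
Qed.

HB.instance Definition _ := Uniform_isComplete.Build (bop R)
  (seq_complete bop_seq_complete).

Fact bop_cnormM a b : `|bop_comp a b| <= `|a| * `|b|.
Proof. by rewrite !rnormE -rmorphM lecR; exact: opnormM. Qed.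

Fact bop_cnorm_star a : `|bop_comp (bop_star a) a| = `|a| ^+ 2.
Proof. by rewrite !rnormE -rmorphXn; congr (_%:C); exact: opnorm_starM. Qed.

HB.instance Definition _ := isCstarAlgebra.Build R (bop R)
  (@bop_compA R) (@bop_compDl R) (@bop_compDr R) (@bop_compZl R) (@bop_compZr R)
  (@bop_starK R) (@bop_starD R) (@bop_starZ R) (@bop_star_comp R)
  bop_cnormM bop_cnorm_star.

End OperatorAlgebra.

(** * Partial permutations of an orthonormal basis *)

Section PartialPermutations.
Local Open Scope complex_scope.
Variable R : realType.
Local Notation H := (l2 R).
Implicit Types (u v : H) (h g : nat -> option nat).

Definition partial_inverse (X : Type) (h g : X -> option X) : Prop :=
  forall i j, h i = Some j <-> g j = Some i.

Definition pull_fun h (u : nat -> R[i]) i : R[i] := if h i is Some j then u j else 0.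

Lemma l2sq_seq u (s : seq nat) : uniq s -> \sum_(j <- s) sqmod (u j) <= l2sq u.
Proof.
move=> us; pose K := (\max_(j <- s) j).+1.
apply: le_trans (l2_part_le u K); rewrite /l2_part -(big_mkord predT (fun i => sqmod (u i))).
have -> : \sum_(j <- s) sqmod (u j) = \sum_(0 <= j < K | j \in s) sqmod (u j).
  rewrite -[RHS]big_filter; apply: perm_big; apply: uniq_perm => //.
    by rewrite filter_uniq// iota_uniq.
  move=> j; rewrite mem_filter mem_index_iota /=.
  have [js /=|//] := boolP (j \in s).
  by rewrite ltnS (@leq_bigmax_seq _ s predT (fun i => i) j js).
rewrite big_mkcond; apply: ler_sum => j _.
by case: ifP => // _; exact: sqmod_ge0.
Qed.

(** [h] is injective on its domain, so the partial sum runs over distinct coordinates of [u]. *)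
Lemma pull_part h g u n : partial_inverse h g -> l2_part (pull_fun h u) n <= l2sq u.
Proof.
move=> hg; have -> : l2_part (pull_fun h u) n = \sum_(j <- pmap h (iota 0 n)) sqmod (u j).
  rewrite /l2_part -(big_mkord predT (fun i => sqmod (pull_fun h u i))) /index_iota subn0.
  elim: (iota 0 n) => [|i s ih]; first by rewrite !big_nil.
  rewrite big_cons ih /= /pull_fun; case: (h i) => [j|] /=; first by rewrite big_cons.
  by rewrite /sqmod /= expr0n addr0 add0r.
apply: l2sq_seq.
have uniq_pmap s : uniq s -> uniq (pmap h s).
  elim: s => //= i s ih /andP[nis us]; case hi: (h i) => [j|] /=; last exact: ih.
  rewrite ih// andbT; apply: contra nis; rewrite mem_pmap => /mapP[i' i's /esym].
  by move/hg; rewrite (hg i j).1// => -[->].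
by apply: uniq_pmap; exact: iota_uniq.
Qed.

Section Pull.
Variables (h g : nat -> option nat).
Hypothesis hg : partial_inverse h g.

Fact pull_subproof u : pull_fun h u \in @l2_pred R.
Proof. by apply/asboolP; exists (l2sq u) => n; exact: pull_part hg. Qed.

Definition pull u : H := L2 (pull_subproof u).

Lemma pullE u i : pull u i = if h i is Some j then u j else 0. Proof. by []. Qed.

Lemma pull_l2sq u : l2sq (pull u) <= l2sq u.
Proof. by apply: l2sq_lub => n; exact: pull_part hg. Qed.

End Pull.

Lemma rip_eq_terms u v u' v' : (forall i, reip (u i) (v i) = reip (u' i) (v' i)) ->
  rip u v = rip u' v'.
Proof.
move=> e; apply: rip_uniq; under eq_fun do under eq_bigr do rewrite e.
exact: rip_cvg.
Qed.

(** Composing the two pullbacks in either order gives the coordinate projections onto the domains of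
    [h] and [g]. Both inner products only see these coordinates, where [pull hg] preserves [l2sq];
    polarisation turns this into preservation of [rip]. *)
Lemma pull_adjoints h g (hg : partial_inverse h g) (gh : partial_inverse g h) :
  adjoints (pull hg) (pull gh).
Proof.
move=> u v.
have hgK i j : h i = Some j -> g j = Some i by move/hg.
have ghK i j : g i = Some j -> h j = Some i by move/hg.
have reip0 z : reip 0 z = 0 :> R by rewrite /reip !mul0r addr0.
have -> : rip (pull hg u) v = rip (pull hg (pull gh (pull hg u))) (pull hg (pull gh v)).
  apply: rip_eq_terms => i; rewrite !pullE; case hi: (h i) => [j|]; last by rewrite !reip0.
  by rewrite !pullE (hgK _ _ hi) !pullE hi.
have -> : rip u (pull gh v) = rip (pull gh (pull hg u)) (pull gh v).
  rewrite ripC [RHS]ripC.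
  apply: rip_eq_terms => i; rewrite !pullE; case gi: (g i) => [j|]; last by rewrite !reip0.
  by rewrite !pullE (ghK _ _ gi).
have iso w : l2sq (pull hg (pull gh w)) = l2sq (pull gh w).
  apply/eqP; rewrite eq_le pull_l2sq /=.
  have {1}<- : pull gh (pull hg (pull gh w)) = pull gh w.
    apply: l2P => i; rewrite !pullE; case gi: (g i) => [j|//].
    by rewrite pullE (ghK _ _ gi) pullE gi.
  exact: pull_l2sq.
have pullD w w' : pull hg (w + w') = pull hg w + pull hg w'.
  by apply: l2P => i; rewrite l2DE !pullE; case: (h i) => [j//|]; rewrite addr0.
have pullN w : pull hg (- w) = - pull hg w.
  by apply: l2P => i; rewrite l2NE !pullE; case: (h i) => [j//|]; rewrite oppr0.
have pullD' w w' : pull gh (w + w') = pull gh w + pull gh w'.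
  by apply: l2P => i; rewrite l2DE !pullE; case: (g i) => [j//|]; rewrite addr0.
have pullN' w : pull gh (- w) = - pull gh w.
  by apply: l2P => i; rewrite l2NE !pullE; case: (g i) => [j//|]; rewrite oppr0.
by rewrite /rip -!pullN -!pullN' -!pullD -!pullD' !iso.
Qed.

Lemma partial_inverse_sym (X : Type) (h g : X -> option X) :
  partial_inverse h g -> partial_inverse g h.
Proof. by move=> hg i j; split => /hg. Qed.

Fact pull_bop_subproof h g (hg : partial_inverse h g) : pull hg \in @bop_pred R.
Proof.
apply/asboolP; exists (pull (partial_inverse_sym hg)), 1; split => //.
- exact: pull_adjoints.
- by move=> u; rewrite mul1r /l2norm ler_wsqrtr// pull_l2sq.
- move=> c u; apply: l2P => i; rewrite l2ZE !pullE.
  by case: (h i) => [j//|]; rewrite mulr0.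
Qed.

Definition pull_bop h g (hg : partial_inverse h g) : bop R := Bop (pull_bop_subproof hg).

Lemma pull_bop_star h g (hg : partial_inverse h g) :
  bop_star (pull_bop hg) = pull_bop (partial_inverse_sym hg).
Proof. by apply: bop_star_uniq; exact: pull_adjoints. Qed.

Fact delta_subproof n : (fun i : nat => ((i == n)%:R : R[i])) \in @l2_pred R.
Proof.
apply/asboolP; exists 1 => m; rewrite /l2_part.
have [nm|mn] := ltnP n m.
  rewrite (bigD1 (Ordinal nm))//= eqxx big1 ?addr0 => [|i].
    by rewrite /sqmod /= expr1n expr0n addr0.
  rewrite -val_eqE /= => /negPf ->; by rewrite /sqmod /= expr0n addr0.
rewrite big1// => i _.
have /ltn_eqF -> : (i < n)%N by exact: leq_trans mn.
by rewrite /sqmod /= expr0n addr0.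
Qed.

Definition delta n : H := L2 (delta_subproof n).

Lemma deltaE n i : delta n i = (i == n)%:R. Proof. by []. Qed.

End PartialPermutations.

Section CodedPartialPermutations.
Local Open Scope complex_scope.
Variables (R : realType) (X : Type) (code : X -> nat) (dec : nat -> option X).
Hypotheses (codeK : forall x, dec (code x) = Some x)
  (decK : forall n x, dec n = Some x -> code x = n).

(** Numbers that are not codes stay outside the domain, so the resulting operator has zero
    coordinates there. *)
Definition coded (phi : X -> option X) n : option nat :=
  obind (fun x => omap code (phi x)) (dec n).

Lemma coded_partial_inverse (phi psi : X -> option X) :
  partial_inverse phi psi -> partial_inverse (coded phi) (coded psi).
Proof.
have H phi' psi' i j : partial_inverse phi' psi' -> coded phi' i = Some j ->
    coded psi' j = Some i.
  move=> pp; rewrite /coded; case di: (dec i) => [x|//] /=.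
  case px: (phi' x) => [y|//] /= [<-]; rewrite codeK /=.
  by rewrite ((pp _ _).1 px) /= (decK di).
by move=> pp i j; split; apply: H => //; exact: partial_inverse_sym.
Qed.

Definition coded_op phi psi (pp : partial_inverse phi psi) : bop R :=
  pull_bop R (coded_partial_inverse pp).

Lemma coded_opE phi psi (pp : partial_inverse phi psi) u x :
  coded_op pp u (code x) = if phi x is Some y then u (code y) else 0.
Proof. by rewrite /coded_op /= /pull_fun /coded codeK /=; case: (phi x). Qed.

Lemma coded_op_out phi psi (pp : partial_inverse phi psi) u n :
  dec n = None -> coded_op pp u n = 0.
Proof. by move=> dn; rewrite /coded_op /= /pull_fun /coded dn. Qed.

Lemma coded_op_star phi psi (pp : partial_inverse phi psi) u x :
  bop_star (coded_op pp) u (code x) = if psi x is Some y then u (code y) else 0.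
Proof.
rewrite /coded_op pull_bop_star /= /pull_fun /coded codeK /=.
by case: (psi x).
Qed.

End CodedPartialPermutations.

(** * Maximal filters of paths *)

Section PathOrder.
Variables (k : nat) (L : kgraph k).
Implicit Types (la mu nu ka : kpath L).
Local Notation "la ∘ mu" := (kgcomp la mu) (at level 40, left associativity).

Lemma extends_refl la : extends la la.
Proof. by exists (idp (src la)); rewrite rng_idp comp_idr. Qed.

Lemma extends_comp la mu : src la = rng mu -> extends (la ∘ mu) la.
Proof. by exists mu. Qed.

Lemma extends_rng la mu : extends la mu -> rng la = rng mu.
Proof. by move=> [mu' [s ->]]; rewrite rng_comp. Qed.

Lemma extends_trans la mu nu : extends la mu -> extends mu nu -> extends la nu.
Proof.
move=> [mu' [s1 ->]] [nu' [s2 e2]]; exists (nu' ∘ mu').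
by move: s1; rewrite e2 src_comp// => s1; rewrite rng_comp// Defs.compA.
Qed.

Lemma extends_idp la : extends la (idp (rng la)).
Proof. by exists la; rewrite src_idp comp_idl. Qed.

Lemma extends_src_notin (H : set (vertex L)) la mu :
  hereditary H -> extends la mu -> ~ H (src la) -> ~ H (src mu).
Proof.
move=> hH [mu' [s ->]]; rewrite src_comp// => h Hs; apply: h.
by apply: hH; rewrite -s.
Qed.

Lemma deg_addI (m n p : {ffun 'I_k -> nat}) : m + n = m + p -> n = p.
Proof.
move=> /ffunP h; apply/ffunP => i; have := h i; rewrite !ffunE.
exact: addnI.
Qed.

(** Left cancellation is the uniqueness half of the factorisation property: equal composites force
    equal degrees of the right factors. *)
Lemma kgcomp_inj mu al be : src mu = rng al -> src mu = rng be ->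
  mu ∘ al = mu ∘ be -> al = be.
Proof.
move=> sa sb e; have da : deg (mu ∘ al) = deg mu + deg al by exact: deg_comp.
have [p [_ pu]] := factorisation da.
have db : deg al = deg be.
  by apply: (@deg_addI (deg mu)); rewrite -!deg_comp// e.
have e1 := pu (mu, al); have e2 := pu (mu, be).
have : (mu, al) = (mu, be) by rewrite -e1 // -e2.
by case.
Qed.

Lemma extends_uniq la mu nu : extends la mu -> extends la nu -> deg mu = deg nu ->
  mu = nu.
Proof.
move=> [mu' [s1 e1]] [nu' [s2 e2]] dmn.
have d1 : deg la = deg mu + deg mu' by rewrite e1 deg_comp.
have [p [_ pu]] := factorisation d1.
have d2 : deg mu' = deg nu'.
  by apply: (@deg_addI (deg mu)); rewrite -deg_comp// dmn -deg_comp// -e1 -e2.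
have h1 := pu (mu, mu'); have h2 := pu (nu, nu').
have : (mu, mu') = (nu, nu') by rewrite -h1 // -h2.
by case.
Qed.

Lemma extends_prefix la (m : {ffun 'I_k -> nat}) : (forall i, m i <= deg la i)%N ->
  exists mu, extends la mu /\ deg mu = m.
Proof.
move=> mla; pose n : {ffun 'I_k -> nat} := [ffun i => (deg la i - m i)%N].
have d : deg la = m + n.
  by apply/ffunP => i; rewrite !ffunE -[RHS]/(_ + _)%N subnKC.
have [[mu nu] [[/= dm dn s e] _]] := factorisation d.
by exists mu; split => //; exists nu.
Qed.

Lemma extends_deg la mu i : extends la mu -> (deg mu i <= deg la i)%N.
Proof.
by move=> [mu' [s ->]]; rewrite deg_comp// ffunE -[leqRHS]/(_ + _)%N leq_addr.
Qed.

(** Take the prefix [ka] of [la] of degree [deg_join]. Its prefixes of degrees [deg mu] and [deg nu]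
    are prefixes of [la] too, hence are [mu] and [nu] by uniqueness. *)
Lemma MCE_prefix la mu nu : extends la mu -> extends la nu ->
  exists2 ka, MCE mu nu ka & extends la ka.
Proof.
move=> lm ln.
have [i|ka [lk dk]] := @extends_prefix la (deg_join (deg mu) (deg nu)).
  by rewrite ffunE geq_max !extends_deg.
have pre ro : extends la ro -> (forall i, deg ro i <= deg ka i)%N -> extends ka ro.
  move=> lr /extends_prefix[ro' [kr dr]].
  by rewrite (extends_uniq lr (extends_trans lk kr)).
exists ka => //; split => //; apply: pre => // i.
  by rewrite dk ffunE leq_maxl.
by rewrite dk ffunE leq_maxr.
Qed.

Lemma extends_cancel la mu nu : src la = rng mu -> src la = rng nu ->
  extends (la ∘ mu) (la ∘ nu) -> extends mu nu.
Proof.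
move=> s1 s2 [ro [s3 e]]; exists ro.
have s4 : src nu = rng ro by rewrite -s3 src_comp.
by split => //; apply: (@kgcomp_inj la); rewrite ?rng_comp// e Defs.compA.
Qed.

Lemma extends_compl la mu nu : src la = rng mu -> extends mu nu ->
  extends (la ∘ mu) (la ∘ nu).
Proof.
move=> s1 mn; have [ro [s2 e]] := mn.
have s3 : src la = rng nu by rewrite s1 (extends_rng mn).
by exists ro; rewrite src_comp// e Defs.compA.
Qed.

End PathOrder.

Section PathFilters.
Variables (k : nat) (L : kgraph k) (H : set (vertex L)).
Hypotheses (fa : finitely_aligned L) (hH : hereditary H) (sH : saturated H).
Implicit Types (la mu nu ka : kpath L) (x y z : set (kpath L)) (v : vertex L).
Local Notation "la ∘ mu" := (kgcomp la mu) (at level 40, left associativity).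

Definition extensions la : set (kpath L) := [set ka | ~ H (src ka) /\ extends ka la].

(** A finite or infinite path all of whose vertices avoid [H], encoded by the set of its finite
    initial segments. *)
Record boundary_filter x : Prop := BoundaryFilter {
  pf_neq0 : x !=set0;
  pf_src : forall la, x la -> ~ H (src la);
  pf_prefix : forall la mu, x la -> extends la mu -> x mu;
  pf_directed : forall la mu, x la -> x mu ->
    exists nu, [/\ x nu, extends nu la & extends nu mu]
}.

Definition maximal_filter x : Prop :=
  boundary_filter x /\ forall y, boundary_filter y -> x `<=` y -> y = x.

Lemma pf_rng x la mu : boundary_filter x -> x la -> x mu -> rng la = rng mu.
Proof.
move=> px xl xm; have [nu [_ nl nm]] := pf_directed px xl xm.
by rewrite -(extends_rng nl) -(extends_rng nm).
Qed.

Lemma pf_idp x la : boundary_filter x -> x la -> x (idp (rng la)).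
Proof. by move=> px xl; apply: pf_prefix xl _ => //; exact: extends_idp. Qed.

Lemma pf_idp_rng x la v : boundary_filter x -> x (idp v) -> x la -> rng la = v.
Proof. by move=> px xv xl; rewrite (pf_rng px xl xv) rng_idp. Qed.

Definition principal la : set (kpath L) := [set mu | extends la mu].

Lemma principal_filter la : ~ H (src la) -> boundary_filter (principal la).
Proof.
move=> hl; split.
- by exists la; exact: extends_refl.
- by move=> mu lm; exact: extends_src_notin lm hl.
- by move=> mu nu; exact: extends_trans.
- by move=> mu nu lm ln; exists la; split => //; exact: extends_refl.
Qed.

Lemma ultra_finite_union (T : Type) (U : set_system T) (I : eqType) (D : set I)
    (B : I -> set T) : UltraFilter U -> finite_set D ->
  U (\bigcup_(i in D) B i) -> exists2 i, D i & U (B i).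
Proof.
move=> uU /finite_seqP[s ->] UB; apply: contrapT => no.
have : U (\bigcap_(i in [set` s]) ~` B i).
  have : forall i, i \in s -> U (~` B i).
    move=> i si; have [UBi|//] := in_ultra_setVsetC (B i) uU.
    by exfalso; apply: no; exists i.
  elim: s {UB no} => [|i s ih] hs.
    by apply: filterS filterT => t _ i.
  have h1 : U (~` B i) by apply: hs; rewrite mem_head.
  have h2 : U (\bigcap_(i in [set` s]) ~` B i).
    by apply: ih => j js; apply: hs; rewrite in_cons js orbT.
  apply: filterS (filterI h1 h2) => t [t1 t2] j /=.
  by rewrite in_cons => /predU1P[->//|]; exact: t2.
by move=> h; have [t [[i si Bi] nB]] := filter_ex (filterI UB h); exact: nB Bi.
Qed.

(* Directedness is where finite alignment enters: an ultrafilter containing the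
   finite union of the [extensions nu], [nu] in [MCE la mu], contains one of them. *)
Lemma ultra_boundary_filter (U : set_system (kpath L)) : UltraFilter U ->
  (exists la, U (extensions la)) -> boundary_filter [set la | U (extensions la)].
Proof.
move=> uU ne; split => //=.
- by move=> la /filter_ex[ka [hk kl]]; exact: extends_src_notin kl hk.
- move=> la mu Ul lm; apply: filterS Ul => ka [hk kl]; split => //.
  exact: extends_trans lm.
- move=> la mu Ul Um.
  have : U (\bigcup_(nu in MCE la mu) extensions nu).
    apply: filterS (filterI Ul Um) => ka [[hk kl] [_ km]].
    by have [nu mnu knu] := MCE_prefix kl km; exists nu.
  move=> /(ultra_finite_union uU (@fa la mu))[nu [_ nl nm] Un].
  by exists nu.
Qed.

(** The sets of common extensions of a member of [x] and a member of [y] form a base of a proper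
    filter on the set of paths. An ultrafilter refining it gives [z]. *)
Lemma compatible_filters x y : boundary_filter x -> boundary_filter y ->
  (forall la mu, x la -> y mu -> extensions la `&` extensions mu !=set0) ->
  exists z, [/\ boundary_filter z, x `<=` z & y `<=` z].
Proof.
move=> px py xy.
pose D := [set p : kpath L * kpath L | x p.1 /\ y p.2].
pose B (p : kpath L * kpath L) := extensions p.1 `&` extensions p.2.
have FF : Filter (filter_from D B).
  apply: filter_from_filter.
    have [la xl] := pf_neq0 px; have [mu ym] := pf_neq0 py.
    by exists (la, mu).
  move=> [l1 m1] [l2 m2] [/= x1 y1] [/= x2 y2].
  have [l [xl h1 h2]] := pf_directed px x1 x2.
  have [m [ym h3 h4]] := pf_directed py y1 y2.
  exists (l, m) => // ka [[/= hk kl] [_ km]]; split; split; split => //=.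
  - exact: extends_trans kl h1.
  - exact: extends_trans km h3.
  - exact: extends_trans kl h2.
  - exact: extends_trans km h4.
have PF : ProperFilter (filter_from D B).
  by apply: filter_from_proper => -[l m] [/= xl ym]; exact: xy.
have [U [uU sub]] := ultraFilterLemma PF.
have Ux la : x la -> U (extensions la).
  move=> xl; have [mu ym] := pf_neq0 py; apply: sub.
  by exists (la, mu) => // ka [].
have Uy mu : y mu -> U (extensions mu).
  move=> ym; have [la xl] := pf_neq0 px; apply: sub.
  by exists (la, mu) => // ka [].
exists [set la | U (extensions la)]; split => //.
by apply: ultra_boundary_filter => //; have [la /Ux ?] := pf_neq0 px; exists la.
Qed.

Lemma compatible_maximal x y : maximal_filter x -> maximal_filter y ->
  (forall la mu, x la -> y mu -> extensions la `&` extensions mu !=set0) -> x = y.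
Proof.
move=> [px mx] [py my] /(compatible_filters px py)[z [pz xz yz]].
by rewrite -(mx z pz xz) (my z pz yz).
Qed.

(** A path compatible with all of [x] has its principal filter compatible with [x], and maximality
    absorbs the common refinement. *)
Lemma maximal_mem x mu : maximal_filter x ->
  (forall la, x la -> extensions la `&` extensions mu !=set0) -> x mu.
Proof.
move=> [px mx] h.
have hm : ~ H (src mu).
  have [la xl] := pf_neq0 px; have [ka [_ [hk km]]] := h _ xl.
  exact: extends_src_notin km hk.
have [|z [pz xz yz]] := compatible_filters px (principal_filter hm).
  move=> la nu xl mn; have [ka [kl [hk km]]] := h _ xl.
  by exists ka; split => //; split => //; exact: extends_trans mn.
by rewrite -(mx z pz xz); apply: yz; exact: extends_refl.
Qed.

Lemma maximal_filter_exists la : ~ H (src la) -> exists2 x, maximal_filter x & x la.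
Proof.
move=> hl.
pose P := [set z : set (kpath L) | z = set0 \/ (boundary_filter z /\ z la)].
have [F FP Ftot|x [Px mx]] := @Zorn_bigcup _ P.
  have [[z [Fz z0]]|no] := pselect (exists z, F z /\ z !=set0); last first.
    left; apply/seteqP; split => // mu [z Fz zm]; apply: no.
    by exists z; split => //; exists mu.
  have FP' w mu : F w -> w mu -> boundary_filter w /\ w la.
    by move=> Fw wm; have [w0|//] := FP _ Fw; move: wm; rewrite w0.
  have [mu0 zm0] := z0; right; split; last by exists z => //; exact: (FP' _ _ Fz zm0).2.
  split.
  - by exists mu0, z.
  - by move=> mu [w Fw wm]; exact: pf_src (FP' _ _ Fw wm).1 _ wm.
  - move=> mu nu [w Fw wm] mn; exists w => //.
    exact: pf_prefix (FP' _ _ Fw wm).1 _ _ wm mn.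
  - move=> mu nu [w Fw wm] [w' Fw' wn].
    have [ww|ww] := Ftot _ _ Fw Fw'.
      have [ro [h1 h2 h3]] := pf_directed (FP' _ _ Fw' wn).1 (ww _ wm) wn.
      by exists ro; split => //; exists w'.
    have [ro [h1 h2 h3]] := pf_directed (FP' _ _ Fw wm).1 wm (ww _ wn).
    by exists ro; split => //; exists w.
have pl := principal_filter hl.
have [x0|[px xl]] := Px.
  exfalso; apply: (mx (principal la)); last by right; split => //; exact: extends_refl.
  rewrite x0; split => // h; have := h la (extends_refl la); exact.
exists x => //; split => // y py xy; apply/seteqP; split => //.
apply: contrapT => nyx; apply: (mx y); first by split.
by right; split => //; exact: xy.
Qed.

(* The extensions of [la] inside [E] form an exhaustive set at [src la], so by
   saturation one of them avoids [H]. *)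
Lemma exhaustive_compatible la (E : set (kpath L)) : ~ H (src la) -> finite_set E ->
  exhaustive (rng la) E -> exists2 mu, E mu & extensions la `&` extensions mu !=set0.
Proof.
move=> hl fE [Er exE]; apply: contrapT => no.
pose F := [set al | src la = rng al /\ exists2 mu, E mu & MCE la mu (la ∘ al)].
have Ffin : finite_set F.
  have fin : finite_set (\bigcup_(mu in E) MCE la mu).
    by apply: bigcup_finite => // mu _; exact: fa.
  (* By left cancellation [al] is recovered from the composite of [la] and [al], so [F] is covered
     by the image of a finite union of sets [MCE la mu]. *)
  pose quo ka := xget la [set al | src la = rng al /\ la ∘ al = ka].
  apply: (@sub_finite_set _ _ (quo @` (\bigcup_(mu in E) MCE la mu))).
    move=> al [s [mu Em m]]; exists (la ∘ al); first by exists mu.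
    have [g1 g2] : [set be | src la = rng be /\ la ∘ be = la ∘ al] (quo (la ∘ al)).
      by apply: (@xgetI _ _ _ al).
    exact: kgcomp_inj g2.
  exact: finite_image.
apply: hl; apply: (sH Ffin).
  split=> [al [s _]|be rbe]; first by rewrite /= -s.
  have s : src la = rng be by [].
  have [mu Em [ka [dk kl km]]] := exE (la ∘ be) (rng_comp s).
  have kla := extends_trans kl (extends_comp s).
  have [nu mnu knu] := MCE_prefix kla km.
  have [_ [al [sa e]] _] := mnu.
  exists al; first by split => //; exists mu => //; rewrite -e.
  have [be' [s1 e1]] := kl.
  have kbe : extends (be ∘ be') be by apply: extends_comp; rewrite -s1 src_comp.
  have kal : extends (be ∘ be') al.
    apply: (@extends_cancel _ _ la) => //; first by rewrite rng_comp// -s1 src_comp.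
    by rewrite Defs.compA// -?e1 -?e// -s1 src_comp.
  by have [c mc _] := MCE_prefix kbe kal; exists c.
move=> _ [al [s [mu Em mm]] <-]; apply: contrapT => hal; apply: no.
exists mu => //; exists (la ∘ al); have [_ el em] := mm.
by split; split => //; rewrite src_comp.
Qed.

(** If [x] missed [E], each element of [E] would be incompatible with some member of [x]. As [E] is
    finite and [x] directed, a single member of [x] would be incompatible with all of [E], against
    [exhaustive_compatible]. *)
Lemma maximal_exhaustive x v (E : set (kpath L)) : maximal_filter x -> x (idp v) ->
  finite_set E -> exhaustive v E -> exists2 mu, E mu & x mu.
Proof.
move=> mx xv fE exE; apply: contrapT => no; have [px _] := mx.
have far mu : E mu -> exists2 la, x la & extensions la `&` extensions mu = set0.
  move=> Em; apply: contrapT => h; apply: no; exists mu => //.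
  apply: maximal_mem => // la xl; apply/set0P/eqP => e.
  by apply: h; exists la.
have [la xl hla] : exists2 la, x la & forall mu, E mu ->
    extensions la `&` extensions mu = set0.
  have /finite_seqP[s Es] := fE; rewrite Es in far *.
  elim: s {fE Es no exE} far => [|mu s ih] far.
    by exists (idp v).
  have [|l1 x1 h1] := ih; first by move=> nu ns; apply: far; rewrite /= in_cons ns orbT.
  have [|l2 x2 h2] := far mu; first by rewrite /= mem_head.
  have [l3 [x3 e1 e2]] := pf_directed px x1 x2; exists l3 => // nu /=.
  have sub l l' : extends l' l -> extensions l' `<=` extensions l.
    by move=> e ka [hk kl]; split => //; exact: extends_trans kl e.
  rewrite in_cons => /predU1P[->|ns]; apply/seteqP; split => // ka [ka1 ka2].
    by rewrite -h2; split => //; exact: sub ka1.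
  by rewrite -(h1 nu ns); split => //; exact: sub ka1.
have rl : rng la = v by exact: pf_idp_rng xl.
have [||mu Em [ka kk]] := @exhaustive_compatible la E _ fE.
- exact: pf_src xl.
- by rewrite rl.
by have := hla mu Em; rewrite -subset0 => /(_ _ kk).
Qed.

(** Closing under prefixes is necessary: a prefix of [la ∘ nu] need not be comparable with [la]. *)
Definition prepend la x : set (kpath L) :=
  [set mu | exists nu, [/\ x nu, rng nu = src la & extends (la ∘ nu) mu]].

Definition truncate la x : set (kpath L) := [set nu | rng nu = src la /\ x (la ∘ nu)].

Lemma prepend_filter la x : boundary_filter x -> x (idp (src la)) -> boundary_filter (prepend la x).
Proof.
move=> px xl; have rx nu : x nu -> rng nu = src la by move=> xn; exact: pf_idp_rng xn.
split.
- exists la, (idp (src la)); split => //; first exact: rx.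
  by rewrite comp_idr; exact: extends_refl.
- move=> mu [nu [xn rn e]]; apply: extends_src_notin e _ => //.
  by rewrite src_comp//; exact: pf_src xn.
- by move=> mu mu' [nu [xn rn e]] e'; exists nu; split => //; exact: extends_trans e'.
- move=> m1 m2 [n1 [x1 r1 e1]] [n2 [x2 r2 e2]].
  have [n [xn h1 h2]] := pf_directed px x1 x2; have rn := rx _ xn.
  exists (la ∘ n); split.
  + by exists n; split => //; exact: extends_refl.
  + by apply: extends_trans e1; exact: extends_compl.
  + by apply: extends_trans e2; exact: extends_compl.
Qed.

Lemma truncate_filter la x : boundary_filter x -> x la -> boundary_filter (truncate la x).
Proof.
move=> px xl; split.
- by exists (idp (src la)); rewrite /truncate /= rng_idp comp_idr.
- by move=> nu [rn xn]; rewrite -(src_comp (esym rn)); exact: pf_src xn.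
- move=> mu nu [rm xm] e; have rn : rng nu = src la by rewrite -(extends_rng e).
  by split => //; apply: pf_prefix xm _ => //; exact: extends_compl.
- move=> m1 m2 [r1 x1] [r2 x2].
  have [n [xn e1 e2]] := pf_directed px x1 x2.
  have [ro [s e]] := extends_trans e1 (extends_comp (esym r1)).
  exists ro; split; first by rewrite /truncate /= -e.
    by apply: (@extends_cancel _ _ la) => //; rewrite -e.
  by apply: (@extends_cancel _ _ la) => //; rewrite -e.
Qed.

Lemma prepend_mem la x : x (idp (src la)) -> prepend la x la.
Proof.
move=> xl; exists (idp (src la)); rewrite rng_idp comp_idr; split => //.
exact: extends_refl.
Qed.

Lemma truncate_idp la x : x la -> truncate la x (idp (src la)).
Proof. by move=> xl; rewrite /truncate /= rng_idp comp_idr. Qed.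

Lemma prependK la x : boundary_filter x -> x (idp (src la)) -> truncate la (prepend la x) = x.
Proof.
move=> px xl; apply/seteqP; split => nu.
  move=> [rn [nu' [xn' rn' e]]]; apply: pf_prefix xn' _ => //.
  exact: extends_cancel e.
move=> xn; have rn := pf_idp_rng px xl xn.
by split => //; exists nu; split => //; exact: extends_refl.
Qed.

Lemma truncateK la x : boundary_filter x -> x la -> prepend la (truncate la x) = x.
Proof.
move=> px xl; apply/seteqP; split => mu.
  by move=> [nu [[rn xn] _ e]]; exact: pf_prefix xn e.
move=> xm; have [n [xn el em]] := pf_directed px xl xm.
have [ro [s e]] := el; exists ro; split => //; first by rewrite /truncate /= -e.
by rewrite -e.
Qed.

(** A filter [y] above [prepend la x] contains [la], hence is [la] prepended to its own truncation,
    and that truncation contains [x]. *)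
Lemma prepend_maximal la x : maximal_filter x -> x (idp (src la)) ->
  maximal_filter (prepend la x).
Proof.
move=> [px mx] xl; split=> [|y py xy]; first exact: prepend_filter.
have yl : y la by apply: xy; exact: prepend_mem.
rewrite -(truncateK py yl); congr prepend; apply: mx; first exact: truncate_filter.
move=> nu xn; have rn := pf_idp_rng px xl xn; split => //; apply: xy.
by exists nu; split => //; exact: extends_refl.
Qed.

Lemma truncate_maximal la x : maximal_filter x -> x la -> maximal_filter (truncate la x).
Proof.
move=> [px mx] xl; split=> [|y py xy]; first exact: truncate_filter.
have yl : y (idp (src la)) by apply: xy; exact: truncate_idp.
rewrite -(prependK py yl); congr truncate; apply: mx; first exact: prepend_filter.
rewrite -{1}(truncateK px xl) => mu [nu [xn rn e]].
by exists nu; split => //; exact: xy.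
Qed.

Lemma truncate_comp la mu x : boundary_filter x -> src la = rng mu ->
  truncate (la ∘ mu) x = truncate mu (truncate la x).
Proof.
move=> px s; apply/seteqP; split => nu.
  move=> []; rewrite src_comp// => rn xn; split => //.
  by rewrite /truncate /= rng_comp// -?s// Defs.compA.
by move=> [rn [_ xn]]; split; [rewrite src_comp|rewrite -Defs.compA].
Qed.

(** Members of the two filters are prefixes of [eta ∘ t] and [zeta ∘ t] for a common [t] in [x]. The
    hypothesis gives these a common extension avoiding [H], so the two maximal filters are
    compatible and therefore equal. *)
Lemma prepend_periodic eta zeta x : maximal_filter x ->
  src eta = src zeta ->
  (forall tau, rng tau = src eta -> ~ H (src tau) ->
     exists2 ka, MCE (eta ∘ tau) (zeta ∘ tau) ka & ~ H (src ka)) ->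
  x (idp (src eta)) -> prepend eta x = prepend zeta x.
Proof.
move=> mx s per xe; have [px _] := mx.
have xz : x (idp (src zeta)) by rewrite -s.
apply: compatible_maximal; [exact: prepend_maximal|exact: prepend_maximal|].
move=> la mu [n1 [x1 r1 e1]] [n2 [x2 r2 e2]].
have [t [xt t1 t2]] := pf_directed px x1 x2.
have rt := pf_idp_rng px xe xt.
have [ka [_ ke kz] hk] := per t rt (pf_src px xt).
exists ka; split; split => //.
  apply: (extends_trans ke); apply: extends_trans e1.
  by apply: extends_compl => //.
apply: (extends_trans kz); apply: extends_trans e2.
by apply: extends_compl => //; rewrite -s.
Qed.

End PathFilters.

(** * The boundary path representation *)

Section PrependComposition.
Variables (k : nat) (L : kgraph k) (H : set (vertex L)).
Hypothesis hH : hereditary H.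
Implicit Types (la mu nu : kpath L) (x : set (kpath L)) (v : vertex L).
Local Notation "la ∘ mu" := (kgcomp la mu) (at level 40, left associativity).

Lemma truncate_idp_id v x : boundary_filter H x -> x (idp v) -> truncate (idp v) x = x.
Proof.
move=> px xv; apply/seteqP; split => nu; rewrite /truncate /= src_idp.
  by move=> [<-]; rewrite comp_idl.
by move=> xn; have rn := pf_idp_rng px xv xn; rewrite -rn comp_idl.
Qed.

Lemma prepend_idp_id v x : boundary_filter H x -> x (idp v) -> prepend (idp v) x = x.
Proof.
by move=> px xv; rewrite -{1}(truncate_idp_id px xv) (truncateK px xv).
Qed.

Lemma prepend_comp la mu x : boundary_filter H x -> src la = rng mu -> x (idp (src mu)) ->
  prepend la (prepend mu x) = prepend (la ∘ mu) x.
Proof.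
move=> px s xm; have pm := prepend_filter hH px xm.
have ml : prepend mu x (idp (src la)).
  by rewrite s; apply: pf_idp pm _; exact: prepend_mem.
have pl := prepend_filter hH pm ml.
have lm : prepend la (prepend mu x) (la ∘ mu).
  by exists mu; split => //; [exact: prepend_mem|exact: extends_refl].
by rewrite -(truncateK pl lm) (truncate_comp pl s) (prependK pm ml) (prependK px xm).
Qed.

End PrependComposition.

Section Representation.
Local Open Scope complex_scope.
Variables (R : realType) (k : nat) (L : kgraph k) (H : set (vertex L)).
Hypotheses (fa : finitely_aligned L) (hH : hereditary H) (sH : saturated H).
Variable x0 : set (kpath L).
Implicit Types (la mu nu : kpath L) (x y : set (kpath L)) (v : vertex L) (u : l2 R).
Local Notation "la ∘ mu" := (kgcomp la mu) (at level 40, left associativity).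

Definition move_by (m : bool * kpath L) x :=
  if m.1 then prepend m.2 x else truncate m.2 x.

(* Restricting to the orbit of one maximal filter makes the index set countable,
   so that it can be coded into [l2], the square-summable sequences over [nat]. *)
Definition in_path_orbit x : Prop :=
  maximal_filter H x /\ exists w : seq (bool * kpath L), foldr move_by x0 w = x.

Definition orbit_filter := {x : set (kpath L) | in_path_orbit x}.

Lemma orbit_inj (x y : orbit_filter) : sval x = sval y -> x = y.
Proof. by case: x y => [x hx] [y hy] /=; exact: eq_exist. Qed.

Definition orbit_word (x : orbit_filter) : seq (bool * kpath L) :=
  xget [::] [set w : seq (bool * kpath L) | foldr move_by x0 w = sval x].

Lemma orbit_wordP (x : orbit_filter) : foldr move_by x0 (orbit_word x) = sval x.
Proof.
have [_ [w hw]] := svalP x.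
by apply: (@xgetI _ [::] [set w : seq (bool * kpath L) | foldr move_by x0 w = sval x] w).
Qed.

Definition orbit_code (x : orbit_filter) : nat := choice.pickle (orbit_word x).

Lemma orbit_code_inj : injective orbit_code.
Proof.
move=> x y /(pcan_inj (@choice.pickleK _)) e.
by apply: orbit_inj; rewrite -(orbit_wordP x) e orbit_wordP.
Qed.

Definition orbit_dec (n : nat) : option orbit_filter :=
  if pselect (exists x : orbit_filter, orbit_code x = n) is left h
  then Some (projT1 (cid h)) else None.

Lemma orbit_decK n (x : orbit_filter) : orbit_dec n = Some x -> orbit_code x = n.
Proof. by rewrite /orbit_dec; case: pselect => // h [<-]; case: cid. Qed.

Lemma orbit_codeK (x : orbit_filter) : orbit_dec (orbit_code x) = Some x.
Proof.
rewrite /orbit_dec; case: pselect => [h|[]]; last by exists x.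
by case: cid => y /= /orbit_code_inj ->.
Qed.

Lemma orbit_truncate la x : in_path_orbit x -> x la -> in_path_orbit (truncate la x).
Proof.
move=> [mx [w wx]] xl; split; first exact: (truncate_maximal hH).
by exists ((false, la) :: w); rewrite /= wx.
Qed.

Lemma orbit_prepend la x : in_path_orbit x -> x (idp (src la)) -> in_path_orbit (prepend la x).
Proof.
move=> [mx [w wx]] xl; split; first exact: (prepend_maximal hH).
by exists ((true, la) :: w); rewrite /= wx.
Qed.

Definition otruncate la (x : orbit_filter) : option orbit_filter :=
  if pselect (sval x la) is left h then Some (exist _ _ (orbit_truncate (svalP x) h))
  else None.

Definition oprepend la (x : orbit_filter) : option orbit_filter :=
  if pselect (sval x (idp (src la))) is left h
  then Some (exist _ _ (orbit_prepend (svalP x) h)) else None.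

Lemma otruncate_oprepend la : partial_inverse (otruncate la) (oprepend la).
Proof.
move=> x y; have [mx _] := svalP x; have [my _] := svalP y.
have [px py] := (mx.1, my.1).
rewrite /otruncate /oprepend; split.
  case: pselect => // h [e]; have e' : truncate la (sval x) = sval y by rewrite -e.
  case: pselect => [h'|[]]; last by rewrite -e'; exact: truncate_idp.
  by congr Some; apply: orbit_inj; rewrite /= -e' (truncateK px).
case: pselect => // h [e]; have e' : prepend la (sval y) = sval x by rewrite -e.
case: pselect => [h'|[]]; last by rewrite -e'; exact: prepend_mem.
by congr Some; apply: orbit_inj; rewrite /= -e' (prependK py).
Qed.

(** Pulling back along truncation pushes basis vectors forward along prepending: the basis vector at
    [y] goes to the one at [la y] if [y] starts at [src la], and to 0 otherwise. *)
Definition path_op la : bop R :=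
  coded_op R orbit_codeK orbit_decK (otruncate_oprepend la).

(** The coordinate of [u] at [x], made total on sets of paths so that equations between filters can
    be rewritten without transporting membership proofs. *)
Definition value u x : R[i] :=
  if pselect (in_path_orbit x) is left h then u (orbit_code (exist _ x h)) else 0.

Lemma valueE u (x : orbit_filter) : value u (sval x) = u (orbit_code x).
Proof.
rewrite /value; case: pselect => [h|[]]; last exact: svalP.
by congr (u (orbit_code _)); exact: orbit_inj.
Qed.

Lemma value_path_op la u x : in_path_orbit x ->
  value (path_op la u) x = if `[< x la >] then value u (truncate la x) else 0.
Proof.
move=> ox; have -> : x = sval (exist _ x ox : orbit_filter) by [].
rewrite valueE coded_opE /otruncate; case: pselect => h; case: asboolP => // h'.
by rewrite -valueE.
Qed.

Lemma value_path_op_star la u x : in_path_orbit x ->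
  value (bop_star (path_op la) u) x =
    if `[< x (idp (src la)) >] then value u (prepend la x) else 0.
Proof.
move=> ox; have -> : x = sval (exist _ x ox : orbit_filter) by [].
rewrite valueE coded_op_star /oprepend; case: pselect => h; case: asboolP => // h'.
by rewrite -valueE.
Qed.

(** Operator identities are checked at the codes of filters through [value]; this condition settles
    the remaining indices. *)
Definition supported (a : bop R) : Prop :=
  forall u n, orbit_dec n = None -> a u n = 0.

Lemma supported_ext (a b : bop R) : supported a -> supported b ->
  (forall u x, in_path_orbit x -> value (a u) x = value (b u) x) -> a = b.
Proof.
move=> sa sb ab; apply: bopP => u; apply: l2P => n.
case dn: (orbit_dec n) => [x|]; last by rewrite sa// sb.
by rewrite -(orbit_decK dn) -!valueE ab//; exact: svalP.
Qed.

Lemma supported_path_op la : supported (path_op la).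
Proof. by move=> u n dn; rewrite /path_op coded_op_out. Qed.

Lemma supported_path_op_star la : supported (bop_star (path_op la)).
Proof.
move=> u n dn; rewrite /path_op /coded_op pull_bop_star /= /pull_fun /coded.
by rewrite dn.
Qed.

Lemma supported_comp a b : supported a -> supported (cmul a b).
Proof. by move=> sa u n dn; exact: sa. Qed.

Lemma supportedB a b : supported a -> supported b -> supported (a - b).
Proof.
move=> sa sb u n dn; have -> : (a - b) u n = a u n - b u n by [].
by rewrite sa// sb// subr0.
Qed.

Lemma supported0 : supported 0. Proof. by []. Qed.

Lemma supported_sum (I : Type) (s : seq I) (F : I -> bop R) :
  (forall i, supported (F i)) -> supported (\sum_(i <- s) F i).
Proof.
move=> sF; elim/big_rec: _ => [//|i a _ sa] u n dn.
have -> : (F i + a) u n = F i u n + a u n by [].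
by rewrite sF// sa// addr0.
Qed.

Lemma valueB (a b : bop R) u x : value ((a - b) u) x = value (a u) x - value (b u) x.
Proof. by rewrite /value; case: pselect => // h; rewrite subr0. Qed.

Lemma value_sum (I : Type) (s : seq I) (F : I -> bop R) u x :
  value ((\sum_(i <- s) F i) u) x = \sum_(i <- s) value (F i u) x.
Proof.
elim: s => [|i s ih]; first by rewrite !big_nil /value; case: pselect.
rewrite !big_cons -ih /value; case: pselect => // h; by rewrite addr0.
Qed.

(** The range projections are diagonal, which makes (CK4) a pointwise statement about filters. *)
Lemma value_range_proj la u x : in_path_orbit x ->
  value (path_op la (bop_star (path_op la) u)) x = if `[< x la >] then value u x else 0.
Proof.
move=> ox; rewrite value_path_op//; case: asboolP => // xl.
rewrite value_path_op_star; last exact: orbit_truncate.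
by rewrite asboolT; [rewrite (truncateK ox.1.1)|exact: truncate_idp].
Qed.

Lemma range_proj_neq0 la x : in_path_orbit x -> x la ->
  cmul (path_op la) (cstar (path_op la)) <> 0.
Proof.
move=> ox xl e; pose d := delta R (orbit_code (exist _ x ox)).
have e0 : path_op la (bop_star (path_op la) d) = 0 := congr1 (fun a : bop R => a d) e.
have := value_range_proj la d ox; rewrite e0 asboolT//.
have -> : x = sval (exist _ x ox : orbit_filter) by [].
rewrite !valueE /d deltaE eqxx => /esym/eqP; by rewrite oner_eq0.
Qed.

Lemma path_op_idp_star v : bop_star (path_op (idp v)) = path_op (idp v).
Proof.
apply: supported_ext => [||u x ox]; [exact: supported_path_op_star|exact: supported_path_op|].
rewrite value_path_op_star// value_path_op// src_idp; case: asboolP => // xv.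
by rewrite (prepend_idp_id ox.1.1)// (truncate_idp_id ox.1.1).
Qed.

Lemma value_path_op_idp v u x : in_path_orbit x ->
  value (path_op (idp v) u) x = if `[< x (idp v) >] then value u x else 0.
Proof.
move=> ox; rewrite value_path_op//; case: asboolP => // xv.
by rewrite (truncate_idp_id ox.1.1).
Qed.

Lemma path_op_comp mu nu : src mu = rng nu ->
  cmul (path_op mu) (path_op nu) = path_op (mu ∘ nu).
Proof.
move=> s; apply: supported_ext => [||u x ox].
- by apply: supported_comp; exact: supported_path_op.
- exact: supported_path_op.
have px := ox.1.1.
rewrite [LHS]value_path_op// [RHS]value_path_op// (truncate_comp px s).
case: asboolP => xm; last first.
  by rewrite asboolF// => xmn; apply: xm; exact: (pf_prefix px) xmn (extends_comp s).
rewrite value_path_op; last exact: orbit_truncate.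
by congr (if _ then _ else _); apply/asboolP/asboolP => [[]|].
Qed.

(** Turns the sum in (CK3) into a sum over a finite list. A pair is recovered from its composite in
    [MCE mu nu] by left cancellation. *)
Lemma MCE_pairs_finite mu nu : finite_set [set p : kpath L * kpath L |
  [/\ src mu = rng p.1, src nu = rng p.2, mu ∘ p.1 = nu ∘ p.2 & MCE mu nu (mu ∘ p.1)]].
Proof.
pose quo la ka := xget la [set al | src la = rng al /\ la ∘ al = ka].
have quoE la al : src la = rng al -> quo la (la ∘ al) = al.
  move=> s; have [g1 g2] : [set be | src la = rng be /\ la ∘ be = la ∘ al] (quo la (la ∘ al)).
    by apply: (@xgetI _ _ _ al).
  exact: kgcomp_inj g2.
apply: (@sub_finite_set _ _ ((fun ka => (quo mu ka, quo nu ka)) @` MCE mu nu)).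
  move=> [al be] [/= s1 s2 e m]; exists (mu ∘ al) => //.
  by rewrite quoE// e quoE.
by apply: finite_image; exact: fa.
Qed.

(** At a filter [x], the left side is non-zero only if [x] starts at [src mu] and [mu x] contains
    [nu]. Then [MCE_prefix] yields a pair [(al, be)] with [al] in [x]. It is the only contributing
    one: all first components have the same degree, and a directed [x] contains at most one path of
    each degree. *)
Lemma path_op_MCE mu nu : cmul (cstar (path_op mu)) (path_op nu) =
  \sum_(p \in [set p : kpath L * kpath L |
        [/\ src mu = rng p.1, src nu = rng p.2,
            mu ∘ p.1 = nu ∘ p.2 & MCE mu nu (mu ∘ p.1)]])
      cmul (path_op p.1) (cstar (path_op p.2)).
Proof.
set P := (X in \sum_(p \in X) _); have Pfin : finite_set P := MCE_pairs_finite mu nu.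
rewrite (fsbig_finite _ _ Pfin); apply: supported_ext => [||u x ox].
- by apply: supported_comp; exact: supported_path_op_star.
- by apply: supported_sum => p; apply: supported_comp; exact: supported_path_op.
have px := ox.1.1.
have [F [-> term term0]] : exists F : kpath L * kpath L -> R[i],
  [/\ value ((\sum_(p <- fset_set P) cmul (path_op p.1) (cstar (path_op p.2))) u) x =
        \sum_(p <- fset_set P) F p,
      forall p, P p -> x p.1 -> F p = value u (prepend p.2 (truncate p.1 x)) &
      forall p, ~ x p.1 -> F p = 0].
  exists (fun p => value (path_op p.1 (bop_star (path_op p.2) u)) x); split.
  - by rewrite value_sum.
  - move=> p [s1 s2 e m] xp; rewrite value_path_op// asboolT//.
    rewrite value_path_op_star; last exact: orbit_truncate.
    by rewrite asboolT// -(src_comp s2) -e src_comp//; exact: truncate_idp.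
  - by move=> p xp; rewrite value_path_op// asboolF.
rewrite [LHS]value_path_op_star//.
have mem p : P p -> x p.1 -> x (idp (src mu)) /\ prepend mu x nu.
  move=> [s1 s2 e [_ _ en]] xp; split; first by rewrite s1; exact: pf_idp px xp.
  by exists p.1.
have [[xm cn]|no] := pselect (x (idp (src mu)) /\ prepend mu x nu); last first.
  rewrite big1_seq => [|p /= Pp].
    case: asboolP => // xm; rewrite value_path_op; last exact: orbit_prepend.
    by rewrite asboolF// => cn; apply: no.
  have {}Pp : P p by move: Pp; rewrite in_fset_set// => /set_mem.
  by have [/(mem p Pp)//|/term0] := pselect (x p.1).
rewrite asboolT// value_path_op ?asboolT//; last exact: orbit_prepend.
have [k' [xk rk en]] := cn.
have [ka mka kka] := MCE_prefix (extends_comp (esym rk)) en.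
have [_ [al [sa ea]] [be [sb eb]]] := mka.
have xa : x al.
  apply: (pf_prefix px xk); apply: (@extends_cancel _ _ mu) => //.
  by rewrite -ea.
have Pab : P (al, be) by split => //=; rewrite -?ea.
rewrite (bigD1_seq (al, be)) /=; last 2 first.
- by rewrite in_fset_set// mem_set.
- exact: fset_uniq.
rewrite (term _ Pab xa)/= big1_seq ?addr0 => [|[al' be'] /= /andP[ne]]; last first.
  rewrite in_fset_set// => /set_mem Pp; have [xa'|xa'] := pselect (x al'); last exact: term0.
  have [s1 s2 e [d1 _ _]] := Pp; exfalso; move/eqP: ne; apply.
  have [ro [_ r1 r2]] := pf_directed px xa xa'.
  have da : deg al' = deg al.
    apply: (@deg_addI _ (deg mu)); rewrite -!deg_comp//.
    by have [da _ _] := mka; rewrite d1 -ea da.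
  have eal : al' = al := extends_uniq r2 r1 da.
  congr pair => //; apply: (@kgcomp_inj _ _ nu) => //.
  by move: e => /= <-; rewrite eal -ea eb.
congr value.
(* With [x = al y], both filters come from [mu al y = nu be y] by removing [nu]. *)
have py := truncate_filter px xa; have yi := truncate_idp xa.
have sab : src be = src al by rewrite -(src_comp sb) -eb ea src_comp.
rewrite -{1}(truncateK px xa) (prepend_comp hH py sa yi) -ea eb.
rewrite -(prepend_comp hH py sb) ?sab//.
rewrite (prependK (H := H))//; first by apply: prepend_filter => //; rewrite sab.
rewrite sb; apply: (pf_idp (H := H)); first by apply: prepend_filter => //; rewrite sab.
by apply: prepend_mem; rewrite sab.
Qed.

Lemma value_gap v la u x : in_path_orbit x ->
  value ((path_op (idp v) - cmul (path_op la) (cstar (path_op la))) u) x =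
  (`[< x (idp v) >]%:R - `[< x la >]%:R) * value u x.
Proof.
move=> ox; rewrite valueB value_path_op_idp// [X in _ - X]value_range_proj//.
by do 2 case: asboolP => _; rewrite ?subr0 ?sub0r ?subrr ?mul1r ?mul0r// mulN1r.
Qed.

Lemma value_cprod (s : seq (kpath L)) v (a : bop R) (c : R[i]) x : in_path_orbit x ->
  (forall u, value (a u) x = c * value u x) -> forall u,
  value (foldl cmul a
    [seq path_op (idp v) - cmul (path_op la) (cstar (path_op la)) | la <- s] u) x =
  c * \prod_(la <- s) (`[< x (idp v) >]%:R - `[< x la >]%:R) * value u x.
Proof.
move=> ox; elim: s a c => [|la s ih] a c ha u /=; first by rewrite big_nil mulr1.
rewrite big_cons mulrA; apply: ih => w; by rewrite [LHS]ha value_gap// mulrA.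
Qed.

(** The product is diagonal, and some factor vanishes at each [x]: if [x] starts at [v] it contains
    an element of [E] and that factor is [1 - 1]; otherwise [x] contains no element of [E] and every
    factor is [0 - 0]. *)
Lemma path_op_exhaustive v (E : {fset kpath L}) : exhaustive v [set` E] ->
  cprod [seq path_op (idp v) - cmul (path_op la) (cstar (path_op la)) | la <- enum_fset E] = 0.
Proof.
move=> exE.
have supp_f la : supported (path_op (idp v) - cmul (path_op la) (cstar (path_op la))).
  apply: supportedB; first exact: supported_path_op.
  by apply: supported_comp; exact: supported_path_op.
have supp_foldl (s : seq (kpath L)) (a : bop R) : supported a -> supported (foldl cmul a
    [seq path_op (idp v) - cmul (path_op la) (cstar (path_op la)) | la <- s]).
  by elim: s a => //= la s ih a sa; apply: ih; exact: supported_comp.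
have zero x : in_path_orbit x -> exists2 la, la \in enum_fset E &
    (`[< x (idp v) >]%:R - `[< x la >]%:R : R[i]) = 0.
  move=> ox; have [xv|xv] := pselect (x (idp v)).
    have [la El xl] := maximal_exhaustive fa hH sH ox.1 xv (finite_fset E) exE.
    by exists la => //; rewrite !asboolT// subrr.
  (* Exhaustiveness tested at the trivial path shows that [E] has an element. *)
  have [la El _] := exE.2 (idp v) (rng_idp v); exists la => //.
  rewrite !asboolF ?subrr// => xl; apply: xv.
  by rewrite -(exE.1 _ El); exact: pf_idp ox.1.1 xl.
move: zero; case: (enum_fset E) => [//|l s] zero /=.
apply: supported_ext => [||u x ox]; last 2 first.
- exact: supported0.
- have [la Ela c0] := zero x ox.
  have e0 : \prod_(j <- l :: s) (`[< x (idp v) >]%:R - `[< x j >]%:R : R[i]) = 0.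
    by apply/eqP; rewrite prodf_seq_eq0; apply/hasP; exists la => //; rewrite /= c0.
  rewrite (value_cprod s v ox (fun w => value_gap v l w ox)).
  by rewrite big_cons in e0; rewrite e0 mul0r /value; case: pselect.
exact: supp_foldl.
Qed.

Lemma path_op_CK : CK_family path_op.
Proof.
split.
- move=> v; split; last exact: path_op_idp_star.
  by rewrite path_op_comp ?src_idp ?rng_idp// -{1}(rng_idp v) comp_idl.
- move=> v w vw; apply: supported_ext => [||u x ox].
  + by apply: supported_comp; exact: supported_path_op.
  + exact: supported0.
  rewrite [LHS]value_path_op_idp//; case: asboolP => [xv|_]; last first.
    by rewrite /value; case: pselect.
  rewrite value_path_op_idp//; case: asboolP => [xw|_]; last first.
    by rewrite /value; case: pselect.
  by have := pf_idp_rng ox.1.1 xv xw; rewrite rng_idp => /esym.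
- exact: path_op_comp.
- exact: path_op_MCE.
- exact: path_op_exhaustive.
Qed.

End Representation.

(** * Aperiodicity *)

Section GaugePhase.
Local Open Scope complex_scope.
Variables (R : realType) (k : nat).

Lemma torus_exp_norm (z : cvec R k) (m : {ffun 'I_k -> nat}) : torus z ->
  `|torus_exp z m| = 1.
Proof.
move=> tz; rewrite /torus_exp normr_prod big1// => i _.
by rewrite normrX tz expr1n.
Qed.

(** In a coordinate where the degrees differ, take a root of -1 of order the difference of the two
    entries, and 1 elsewhere; the two phases then differ by a sign. *)
Lemma torus_exp_separates (m n : {ffun 'I_k -> nat}) : m <> n ->
  exists2 z : cvec R k, torus z & torus_exp z m <> torus_exp z n.
Proof.
have main (a b : {ffun 'I_k -> nat}) i : (a i < b i)%N ->
    exists2 z : cvec R k, torus z & torus_exp z a <> torus_exp z b.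
  move=> ab; have d0 : (0 < b i - a i)%N by rewrite subn_gt0.
  have [w wd] : exists w : R[i], w ^+ (b i - a i) = -1.
    by exists ((b i - a i).-root (-1)); exact: rootCK.
  have w1 : `|w| = 1.
    apply/eqP; rewrite -(@pexpr_eq1 _ _ (b i - a i))//.
    by rewrite -normrX wd normrN1.
  pose z : cvec R k := \row_j (if j == i then w else 1).
  have expz (c : {ffun 'I_k -> nat}) : torus_exp z c = w ^+ c i.
    rewrite /torus_exp (bigD1 i)//= big1 => [|j ji]; last first.
      by rewrite mxE (negPf ji) expr1n.
    by rewrite mulr1 mxE eqxx.
  exists z; first by move=> j; rewrite mxE; case: eqP => // _; rewrite normr1.
  rewrite !expz -(subnKC (ltnW ab)) exprD wd => /eqP.
  rewrite mulrN1 -addr_eq0 -mulr2n mulrn_eq0 /= expf_eq0 => /andP[_ /eqP w0].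
  by move: w1; rewrite w0 normr0 => /esym/eqP; rewrite oner_eq0.
move=> mn; have [i mi] : exists i, m i != n i.
  apply: contrapT => h; apply: mn; apply/ffunP => i; apply/eqP.
  by apply: contrapT => /negP mi; apply: h; exists i.
case: ltngtP mi => // mi _; first exact: main mi.
by have [z tz e] := main _ _ _ mi; exists z => // /esym.
Qed.

End GaugePhase.

Section Aperiodicity.
Variables (R : realType) (k : nat) (L : kgraph k).
Hypothesis fa : finitely_aligned L.
Variables (A : cstarAlgType R) (S : kpath L -> A) (gam : cvec R k -> A -> A).
Hypotheses (hA : is_graph_algebra S) (hgam : gauge_action S gam) (hAF : is_AF A).
Local Notation "la ∘ mu" := (kgcomp la mu) (at level 40, left associativity).

(* The kernel of [f] is gauge-invariant, and the gauge action multiplies the two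
   sides of the relation by different phases. *)
Lemma AF_degree_collapse (B : cstarAlgType R) (f : A -> B) (T : kpath L -> B)
    (eta zeta : kpath L) :
  star_hom f -> (forall la, f (S la) = T la) -> deg eta <> deg zeta ->
  cmul (T eta) (cstar (T zeta)) = cmul (T eta) (cstar (T eta)) ->
  cmul (T eta) (cstar (T eta)) = 0.
Proof.
move=> hf fS dne TT; have kerI := star_hom_ker_ideal hf.
pose P := cmul (S eta) (cstar (S eta)).
pose W := cmul (S eta) (cstar (S zeta)).
have fM x y : f (cmul x (cstar y)) = cmul (f x) (cstar (f y)).
  by rewrite (star_homM hf) (star_homS hf).
have fW : f W = cmul (T eta) (cstar (T eta)) by rewrite fM !fS.
have fP : f P = cmul (T eta) (cstar (T eta)) by rewrite fM fS.
have WP : f (W - P) = 0 by rewrite (star_homB hf) fP fW subrr.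
have [z tz zne] := torus_exp_separates R dne.
have hz := gauge_hom hgam tz.
have gW la : gam z (cmul (S eta) (cstar (S la))) =
    (torus_exp z (deg eta) * ((torus_exp z (deg la))^* )%R) *: cmul (S eta) (cstar (S la)).
  rewrite (star_homM hz) (star_homS hz) !(gauge_generator hgam _ tz).
  by rewrite cstarZ cmulZl cmulZr scalerA.
have : f (gam z (W - P)) = 0.
  by apply: (AF_gauge_invariant hgam kerI hAF tz); exists (W - P).
rewrite (star_homB hz) !gW (star_homB hf) !(star_homZ hf) -/W -/P fW fP.
rewrite -scalerBl => /eqP; rewrite scaler_eq0 => /orP[|/eqP //].
rewrite -mulrBr -rmorphB mulf_eq0 => /orP[/eqP z0|].
  have := torus_exp_norm (deg eta) tz; rewrite z0 normr0 => /esym/eqP.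
  by rewrite oner_eq0.
by rewrite conjC_eq0 subr_eq0 => /eqP e; exfalso; apply: zne.
Qed.

Theorem AF_aperiodic_quotients (H : set (vertex L)) : saturated H -> hereditary H ->
  forall eta zeta : kpath L, eta <> zeta -> ~ H (src eta) -> src eta = src zeta ->
  exists tau : kpath L, [/\ rng tau = src eta, ~ H (src tau) &
    MCE (eta ∘ tau) (zeta ∘ tau) `<=` paths_into H].
Proof.
move=> sH hH eta zeta ne he s; apply: contrapT => no.
have per tau : rng tau = src eta -> ~ H (src tau) ->
    exists2 ka, MCE (eta ∘ tau) (zeta ∘ tau) ka & ~ H (src ka).
  move=> rt ht; apply: contrapT => h; apply: no; exists tau; split => // ka mka.
  by apply: contrapT => hka; apply: h; exists ka.
(* The trivial [tau] gives a common extension of [eta] and [zeta], and a path has only one prefix of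
   each degree. *)
have dne : deg eta <> deg zeta.
  move=> de; apply: ne; have [||ka [_ ke kz] _] := per (idp (src eta)).
  - exact: rng_idp.
  - by rewrite src_idp.
  by move: ke kz; rewrite comp_idr s comp_idr => ke kz; exact: (extends_uniq ke kz de).
have [x0 mx0 x0e] : exists2 x0, maximal_filter H x0 & x0 (idp (src eta)).
  by apply: maximal_filter_exists => //; rewrite src_idp.
pose T := path_op R hH x0.
have [f hf fS] := graph_algebra_universal hA (path_op_CK R fa hH sH x0 : CK_family T).
(* If [x] contains [eta], write [x = eta y]. Then [zeta y = eta y = x], so both operators act on the
   coordinate at [x] as the identity; otherwise both give 0. *)
have TT : cmul (T eta) (cstar (T zeta)) = cmul (T eta) (cstar (T eta)).
  apply: (@supported_ext R k L H x0) => [||u x ox].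
  - by apply: supported_comp; exact: supported_path_op.
  - by apply: supported_comp; exact: supported_path_op.
  rewrite [RHS]value_range_proj// [LHS]value_path_op//; case: asboolP => // xe.
  have oy := orbit_truncate hH ox xe; have ye := truncate_idp xe.
  rewrite value_path_op_star// asboolT -?s//.
  by rewrite -(prepend_periodic fa hH oy.1 s per ye) (truncateK ox.1.1 xe).
have T0 := AF_degree_collapse hf fS dne TT.
(* The filter [eta x0] contains [eta], so the range projection of [T eta] fixes a basis vector. *)
have ox : in_path_orbit H x0 (prepend eta x0).
  by split; [exact: prepend_maximal|exists [:: (true, eta)]].
exact: (range_proj_neq0 ox (prepend_mem x0e) T0).
Qed.

End Aperiodicity.

Theorem proposition3p12 (R : realType) (k : nat) (hk : (0 < k)%N)
    (L : kgraph k) (hL : finitely_aligned L)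
    (A : cstarAlgType R) (S : kpath L -> A) (hA : is_graph_algebra S)
    (gam : cvec R k -> A -> A)
    (hgam : gauge_action S gam) (hAF : is_AF A) :
  (forall H : set (vertex L), saturated H -> hereditary H ->
     forall eta zeta : kpath L,
       eta <> zeta -> ~ paths_into H eta -> ~ paths_into H zeta ->
       src eta = src zeta ->
       exists tau : kpath L,
         [/\ rng tau = src eta, ~ paths_into H tau &
             MCE (kgcomp eta tau) (kgcomp zeta tau) `<=` paths_into H]) /\
  (forall I : set A, closed_ideal I -> gauge_invariant gam I).
Proof.
split=> [H sH hH eta zeta ne he _ s|I hI].
  exact: (AF_aperiodic_quotients hL hA hgam hAF sH hH ne he s).
exact: (AF_gauge_invariant hgam hI hAF).
Qed.
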